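(* Consider a conformal graph directed Markov system satisfying assumptions (i), (ii), (iii) of the context, with limit set $\Lambda_A$. For any sequence $(g_i)_{i=1}^\infty$ of real valued continuous functions on $\Sigma_A$, and each sequence $(x_i)_{i=1}^\infty$ of points in $\mathbb R$, it holds that $$\dim_{\mathrm H}\Big(\bigcap_{i=1}^\infty\{y\in\Lambda_A: x_i\in A_{g_i}(y)\}\Big)=\inf_i\,\dim_{\mathrm H}\big(\{y\in\Lambda_A: x_i\in A_{g_i}(y)\}\big).$$
   Context: Setting. $\Sigma_A\subset\{1,\dots,q\}^{\mathbb N}$ is a (one-sided) transitive subshift of finite type with transition matrix $A$, with the product topology; elements are written $\boldsymbol i=i_1i_2\ldots$, and $\sigma(i_1i_2\ldots)=i_2i_3\ldots$ is the shift. $X\subset\mathbb R^n$ is compact and non-empty, and $f_i:X\to X$ ($1\le i\le q$) and $f_{i,j}:X\to X$ ($ij$ a word occurring in $\Sigma_A$) are conformal contractions. The map $\pi:\Sigma_A\to X$ is defined by $\{\pi(\boldsymbol i)\}=\bigcap_{k\ge1} f_{i_1}\circ f_{i_1,i_2}\circ\cdots\circ f_{i_{k-1},i_k}(X)$, and $\Lambda_A=\pi(\Sigma_A)$ is the limit set. This is called a conformal graph directed Markov system. Assumptions. (i) $X$ is the closure of its interior, and the images of the interior of $X$ under the contractions are disjoint: the sets $f_i(\mathrm{int}\,X)$ are pairwise disjoint for different $i$, and for each fixed $i$ the sets $f_{i,j}(\mathrm{int}\,X)$ are pairwise disjoint for different $j$. (ii) There are $0<\lambda_1<\lambda_2<1$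 with $\lambda_1<\|\mathrm d_xf_{i,j}\|<\lambda_2$ and $\lambda_1<\|\mathrm d_xf_i\|<\lambda_2$ for all $i,j$ and $x\in X$. (iii) Either $n>1$, or $n=1$ and there is $\alpha>0$ such that $\big||f_{i,j}'(x)|-|f_{i,j}'(y)|\big|\le \sup_{z\in X}|f_{i,j}'(z)|\,|x-y|^\alpha$ for all $i,j$ and $x,y\in X$, and similarly for the maps $f_i$. Notation. For $g:\Sigma_A\to\mathbb R$ and $x\in\Lambda_A$, $A_g(x)$ is the set of accumulation points, as $N\to\infty$, of the ergodic averages $\frac1N\sum_{k=0}^{N-1}g(\sigma^k\boldsymbol i)$, where $\pi(\boldsymbol i)=x$ (if $x$ has several codings $\boldsymbol i$, accumulation points along any of them are included). $\dim_{\mathrm H}$ is Hausdorff dimension with respect to the Euclidean metric. *)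

(* Defs.v *)
From mathcomp Require Import all_boot all_order all_algebra.
From mathcomp Require Import all_classical all_reals all_analysis.

Set Implicit Arguments.
Unset Strict Implicit.
Unset Printing Implicit Defensive.

Import Order.TTheory GRing.Theory Num.Theory.
Import numFieldNormedType.Exports.

Local Open Scope classical_set_scope.
Local Open Scope ring_scope.

Section Euclidean.
Context {R : realType} {n : nat}.
Local Notation V := 'rV[R]_n.
Implicit Types (x v : V) (E U X : set V) (s delta : R).

(* The library norm on row vectors is the sup norm: it induces the same topology
   and the same differentials, but metric notions below are Euclidean. *)
Definition enorm v : R := Num.sqrt (\sum_j v 0 j ^+ 2).

Definition opnorm (L : V -> V) : R :=
  sup [set enorm (L v) | v in [set v | enorm v <= 1]].

(* ediam set0 = -oo *)
Definition ediam U : \bar R :=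
  ereal_sup [set (enorm (p.1 - p.2))%:E | p in U `*` U].

(* The empty set is separated out because `^ gives 0 `^ 0 = (-oo) `^ 0 = 1: with
   s = 0, a nonempty set has weight 1 and the empty set has weight 0. *)
Definition hausdorff_gauge s U : \bar R :=
  if U == set0 then 0%E else poweR (ediam U) s.

Definition hausdorff_premeasure delta s E : \bar R :=
  ereal_inf [set (\sum_(0 <= k <oo) hausdorff_gauge s (U k))%E | U in
    [set U : nat -> set V | E `<=` \bigcup_k U k /\
                            forall k, (ediam (U k) <= delta%:E)%E]].

Definition hausdorff_measure s E : \bar R :=
  ereal_sup [set hausdorff_premeasure delta s E | delta in
    [set delta | 0 < delta]].

(* The dimension of the empty set is 0. *)
Definition hausdorff_dim E : \bar R :=
  ereal_inf [set s%:E | s in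
    [set s | 0 <= s /\ hausdorff_measure s E = 0%E]].

Definition contraction_on X (f : V -> V) :=
  exists2 c : R, c < 1 &
    forall x y, X x -> X y -> enorm (f x - f y) <= c * enorm (x - y).

Definition similarity (L : V -> V) :=
  exists2 r : R, 0 < r & forall v, enorm (L v) = r * enorm v.

(* Conformality on the compact set X means conformality on an open neighbourhood
   of X (so that 'd f x makes sense at boundary points).  A map X -> X is
   represented by a function on the whole space of which only the values near X
   matter. *)
Definition conformal_on X (f : V -> V) :=
  exists U, [/\ open U, X `<=` U,
    forall x y, U x -> U y -> f x = f y -> x = y,
    forall x, U x -> differentiable f x /\ {for x, continuous (jacobian f)} &
    forall x, U x -> similarity ('d f x)].

Definition conformal_contraction X (f : V -> V) :=
  [/\ f @` X `<=` X, contraction_on X f & conformal_on X f].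

Definition bounded_derivative X (l1 l2 : R) (f : V -> V) :=
  forall x, X x -> l1 < opnorm ('d f x) < l2.

(* When n = 1, opnorm ('d f x) = |f'(x)|. *)
Definition holder_derivative X (alpha : R) (f : V -> V) :=
  forall x y, X x -> X y ->
    `|opnorm ('d f x) - opnorm ('d f y)|
      <= sup [set opnorm ('d f z) | z in X] * enorm (x - y) `^ alpha.

End Euclidean.

(* Symbols and positions are numbered from 0. *)
Notation symbolic_space q := {ptws nat -> discrete_topology 'I_q}.

Section SFT.
Context {q : nat}.
Implicit Types (A : 'M[bool]_q) (s : symbolic_space q).

Definition SFT A : set (symbolic_space q) :=
  [set s | forall k : nat, A (s k) (s k.+1)].

Definition shift s : symbolic_space q := fun k => s k.+1.

Definition occurs A (i j : 'I_q) :=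
  exists2 s, SFT A s & exists k : nat, s k = i /\ s k.+1 = j.

(* The open sets of SFT A are the traces on SFT A of open sets. *)
Definition transitive_SFT A :=
  forall U V : set (symbolic_space q), open U -> open V ->
    SFT A `&` U !=set0 -> SFT A `&` V !=set0 ->
    exists k, SFT A `&` U `&` iter k shift @^-1` V !=set0.

End SFT.

Section GDMS.
Context {R : realType} {n q : nat}.
Local Notation V := 'rV[R]_n.
Variables (A : 'M[bool]_q) (X : set V).
Variables (f : 'I_q -> V -> V) (ff : 'I_q -> 'I_q -> V -> V).
Implicit Types (s : symbolic_space q) (g : symbolic_space q -> R).

Fixpoint word_map s (k : nat) : V -> V :=
  if k is k'.+1 then word_map s k' \o ff (s k') (s k) else f (s 0%N).

(* For s in SFT A the intersection is a singleton; xget returns its element. *)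
Definition coding_map s : V :=
  xget 0 [set x | \bigcap_k (word_map s k @` X) = [set x]].

Definition limit_set : set V := coding_map @` SFT A.

Definition disjoint_images :=
  (forall i i' : 'I_q, i != i' ->
     (f i @` X°) `&` (f i' @` X°) = set0) /\
  (forall i j j' : 'I_q, occurs A i j -> occurs A i j' -> j != j' ->
     (ff i j @` X°) `&` (ff i j' @` X°) = set0).

Definition ergodic_average g s (N : nat) : R :=
  N%:R^-1 * \sum_(k < N) g (iter k shift s).

Definition accumulation_set g (x : V) : set R :=
  [set a | exists s, [/\ SFT A s, coding_map s = x &
                         cluster (ergodic_average g s @ \oo) a]].

End GDMS.

(* Main.v *)
Require Import Defs.
From mathcomp Require Import all_boot all_order all_algebra.
From mathcomp Require Import all_classical all_reals all_analysis.
From mathcomp Require Import ring lra zify.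
Import Defs.
(** The dimension of an intersection is at most each dimension.  Conversely, let [s]
    be smaller than the dimension of every level set
    [E i = {y | x i is an accumulation point of the averages of g i at y}]
    and let [t < s].  The proof constructs a Cantor subset of the intersection of the
    [E i] whose [t]-dimensional Hausdorff measure is positive.

    Its building blocks are found in the level sets separately.  Write [D w] for the
    diameter of the image of [X] under the composition of the maps along a word [w].
    For arbitrarily large [N] there is a family of words [w] of length [N] along which
    the average of [g i] is close to [x i], for which the images of [X] are pairwise
    disjoint and the sum of the [D w `^ s] is at least 1.  Otherwise Vitali's covering
    argument, applied for each large [N] to all the words of length [N] with an average
    close to [x i], would cover [E i] by three-fold enlargements of few images, and
    [E i] would have dimension at most [s] ([large_disjoint_family]).  By transitivity
    the words can be completed to loops at one fixed symbol, which can be concatenated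
    in any order, also when they come from different level sets ([loop_family_exists]).

    Conformality enters through distortion.  A conformal map is nearly a similarity at
    small scales, with a uniform error by compactness.  Hence the inverse Lipschitz
    bound [m w] of the composition along [w] equals [D w] up to a factor
    [(1 + d) ^- size w] with [d] arbitrarily small ([chain_lower_diam]).  Such a factor
    costs an arbitrarily small loss of dimension, since [D w] itself decreases
    exponentially, and thus the sum of the [m w `^ s] is at least 1.

    The points of the Cantor set are coded by the sequences of loops that use, during
    longer and longer stages, a family adapted to one level set with one precision.
    Every level set recurs with precisions that tend to 0, and each stage is much longer
    than everything before it, so that the points lie in all the level sets.  Giving a
    loop the weight [m w `^ s], normalized within its family, defines the mass of a
    cylinder.  Two points that separate after [T] loops are at distance at least the
    product of their first [T] bounds [m w], times the gap between the images in the
    family then in use.  The stages start late enough for this gap to be negligible, and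
    the mass of the common cylinder is at most a constant times the [t]-th power of the
    distance.  The mass distribution principle concludes ([mass_distribution]); it is
    proved on cylinders, without constructing a measure: a countable family of cylinders
    of total mass less than 1 misses a point ([cylinder_avoidance]). *)

Set Implicit Arguments.
Unset Strict Implicit.
Unset Printing Implicit Defensive.
Import Order.TTheory GRing.Theory Num.Theory.
Import numFieldNormedType.Exports.
Local Open Scope classical_set_scope.
Local Open Scope ring_scope.

(** * The Euclidean norm *)

Section EnormTheory.
Context {R : realType} {n : nat}.
Local Notation V := 'rV[R]_n.
Implicit Types u v w x y : V.

Lemma enorm_ge0 v : 0 <= enorm v.
Proof. exact: sqrtr_ge0. Qed.

Lemma enorm_sqr v : enorm v ^+ 2 = \sum_j v 0 j ^+ 2.
Proof. by rewrite /enorm sqr_sqrtr // sumr_ge0 // => j _; exact: sqr_ge0. Qed.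

Lemma enormN v : enorm (- v) = enorm v.
Proof.
by rewrite /enorm; congr Num.sqrt; apply: eq_bigr => j _; rewrite mxE sqrrN.
Qed.

Lemma enormB u v : enorm (u - v) = enorm (v - u).
Proof. by rewrite -enormN opprB. Qed.

Lemma coord_le_enorm v j : `|v 0 j| <= enorm v.
Proof.
rewrite -(ler_sqr (normr_ge0 _) (enorm_ge0 _)) enorm_sqr real_normK ?num_real//.
by rewrite (bigD1 j)//= lerDl sumr_ge0 // => k _; exact: sqr_ge0.
Qed.

Lemma normr_le_enorm v : `|v| <= enorm v.
Proof.
rewrite [leLHS]/Num.Def.normr/= mx_normrE bigmax_le ?enorm_ge0// => -[i j] _.
by rewrite ord1 coord_le_enorm.
Qed.

Lemma coord_le_normr v j : `|v 0 j| <= `|v|.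
Proof.
rewrite [leRHS]/Num.Def.normr/= mx_normrE.
exact: (le_bigmax _ (fun ij : 'I_1 * 'I_n => `|v ij.1 ij.2|) (0, j)).
Qed.

(** The constant is far from optimal, but positive in every dimension. *)
Lemma enorm_le_normr v : enorm v <= n.+1%:R * `|v|.
Proof.
rewrite -(ler_sqr (enorm_ge0 _)) ?nnegrE ?mulr_ge0// enorm_sqr.
apply: (@le_trans _ _ (n%:R * `|v| ^+ 2)).
  apply: (@le_trans _ _ (\sum_(j < n) `|v| ^+ 2)); last first.
    by rewrite sumr_const card_ord mulr_natl.
  apply: ler_sum => j _; rewrite -(real_normK (num_real (v 0 j))).
  by rewrite ler_sqr ?nnegrE// coord_le_normr.
by rewrite exprMn ler_wpM2r ?sqr_ge0// -natrX ler_nat; nia.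
Qed.

Lemma enorm_eq0 v : (enorm v == 0) = (v == 0).
Proof.
apply/eqP/eqP => [v0|->].
  by apply/eqP; rewrite -normr_le0 -v0 normr_le_enorm.
by apply/eqP; rewrite -sqrf_eq0 enorm_sqr big1// => j _; rewrite mxE expr0n.
Qed.

(** Expand the sum of the squares of the coordinates of
    [enorm u ^+ 2 *: v - p *: u], where [p] is the scalar product. *)
Lemma cauchy_schwarz u v : \sum_j u 0 j * v 0 j <= enorm u * enorm v.
Proof.
set p := \sum_j _; have [p0|p0] := ltP p 0.
  by rewrite (le_trans (ltW p0))// mulr_ge0 ?enorm_ge0.
have [/eqP u0|u0] := boolP (enorm u == 0).
  rewrite u0 mul0r /p big1// => j _.
  by have /eqP := u0; rewrite enorm_eq0 => /eqP ->; rewrite mxE mul0r.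
have u2 : 0 < enorm u ^+ 2 by rewrite exprn_gt0// lt0r u0 enorm_ge0.
rewrite -(ler_sqr p0) ?nnegrE ?mulr_ge0 ?enorm_ge0// exprMn.
have : 0 <= \sum_j (enorm u ^+ 2 * v 0 j - p * u 0 j) ^+ 2.
  by apply: sumr_ge0 => j _; exact: sqr_ge0.
have -> : \sum_j (enorm u ^+ 2 * v 0 j - p * u 0 j) ^+ 2 =
    enorm u ^+ 2 * (enorm u ^+ 2 * enorm v ^+ 2 - p ^+ 2).
  have expand (a b : R) : \sum_j (a * v 0 j - b * u 0 j) ^+ 2 =
      a ^+ 2 * (\sum_j v 0 j ^+ 2) - 2 * a * b * (\sum_j u 0 j * v 0 j)
      + b ^+ 2 * \sum_j u 0 j ^+ 2.
    rewrite !mulr_sumr -sumrB -big_split/=; apply: eq_bigr => j _; ring.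
  by rewrite expand -/p -!enorm_sqr; ring.
by rewrite pmulr_rge0// subr_ge0.
Qed.

Lemma enormD u v : enorm (u + v) <= enorm u + enorm v.
Proof.
rewrite -(ler_sqr (enorm_ge0 _)) ?nnegrE ?addr_ge0 ?enorm_ge0//.
have -> : enorm (u + v) ^+ 2 =
    enorm u ^+ 2 + (\sum_j u 0 j * v 0 j) *+ 2 + enorm v ^+ 2.
  rewrite !enorm_sqr -sumrMnl -!big_split/=.
  by apply: eq_bigr => j _; rewrite mxE sqrrD.
by rewrite sqrrD lerD2r lerD2l lerMn2r cauchy_schwarz orbT.
Qed.

Lemma enorm_dist u v w : enorm (u - w) <= enorm (u - v) + enorm (v - w).
Proof. by rewrite (le_trans _ (enormD _ _))// addrA subrK. Qed.

Lemma enormD_ge u v : enorm u - enorm v <= enorm (u + v).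
Proof.
by rewrite lerBlDr -{1}(addrK v u) -[enorm v]enormN enormD.
Qed.

Lemma nbhs_enorm x (A : set V) :
  nbhs x A <-> exists2 r : R, 0 < r & forall y, enorm (y - x) < r -> A y.
Proof.
split=> [/nbhs_ballP[r r0 rA]|[r r0 rA]].
  exists r => // y yx; apply: rA; rewrite -ball_normE/= distrC.
  exact: le_lt_trans (normr_le_enorm _) yx.
apply/nbhs_ballP; exists (r / n.+1%:R); first by rewrite /= divr_gt0.
move=> y; rewrite -ball_normE/= distrC ltr_pdivlMr// mulrC => xy; apply: rA.
exact: le_lt_trans (enorm_le_normr _) xy.
Qed.

End EnormTheory.

(** * Strict differentiability *)

Section StrictDifferentiability.
Context {R : realType} {n : nat}.
Local Notation V := 'rV[R]_n.
Implicit Types (f : V -> V) (u v x y : V).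

Lemma is_derive_line f y v (t : R) j :
  differentiable f (y + t *: v) ->
  is_derive t 1 (fun t : R => f (y + t *: v) 0 j)
    ((v *m jacobian f (y + t *: v)) 0 j).
Proof.
move=> df.
pose g := fun t : R => f (y + t *: v).
have quotE (h : R) : g (h *: 1 + t) - g t = f (h *: v + (y + t *: v)) - f (y + t *: v).
  by rewrite /g [h *: 1]mulr1 scalerDl addrCA.
have dg : derivable g t 1.
  rewrite /derivable; under eq_fun do rewrite quotE.
  exact: diff_derivable.
have Dg : 'D_1 g t = v *m jacobian f (y + t *: v).
  rewrite -deriveEjacobian// /derive.
  by under eq_fun do rewrite quotE.
have dgj : derivable (fun t => g t 0 j) t 1 by have /derivable_mxP := dg; exact.
apply: (DeriveDef dgj).
by rewrite -Dg derive_mx// mxE.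
Qed.

(** The mean value theorem fails for vector valued maps: the intermediate point
    depends on the coordinate. *)
Lemma mean_value_coord f x y j :
  (forall t : R, 0 <= t <= 1 -> differentiable f (y + t *: (x - y))) ->
  exists2 t : R, 0 <= t <= 1 &
    f x 0 j - f y 0 j = ((x - y) *m jacobian f (y + t *: (x - y))) 0 j.
Proof.
move=> df.
have [| |t t01 tE] := @MVT_segment R (fun t => f (y + t *: (x - y)) 0 j)
  (fun t => ((x - y) *m jacobian f (y + t *: (x - y))) 0 j) 0 1 ler01.
- move=> t t01; apply: is_derive_line; apply: df.
  by move: t01; rewrite in_itv/= => /andP[/ltW-> /ltW->].
- apply: derivable_within_continuous => t; rewrite in_itv/= => t01.
  exact: (@ex_derive _ _ _ _ _ _ _ (is_derive_line _ (df _ t01))).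
- exists t; first by move: t01; rewrite in_itv.
  by move: tE; rewrite subr0 mulr1 scale1r scale0r addr0 (addrC y (x - y)) subrK.
Qed.

Lemma segment_enorm x u v (r t : R) : 0 <= t <= 1 ->
  enorm (u - x) < r -> enorm (v - x) < r ->
  enorm (v + t *: (u - v) - x) < r.
Proof.
move=> /andP[t0 t1] ur vr.
have r0 : 0 < r by rewrite (le_lt_trans _ ur)// enorm_ge0.
have enormZ (a : R) (w : V) : 0 <= a -> enorm (a *: w) = a * enorm w.
  move=> a0; rewrite /enorm (eq_bigr (fun j => a ^+ 2 * w 0 j ^+ 2)).
    by rewrite -mulr_sumr sqrtrM ?sqr_ge0// sqrtr_sqr ger0_norm.
  by move=> j _; rewrite mxE exprMn.
have -> : v + t *: (u - v) - x = t *: (u - x) + (1 - t) *: (v - x).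
  by apply/rowP => j; rewrite !mxE; ring.
rewrite (le_lt_trans (enormD _ _))// !enormZ ?subr_ge0//.
have [->|tn0] := eqVneq t 0; first by rewrite mul0r add0r subr0 mul1r.
have t0' : 0 < t by rewrite lt0r tn0.
by nra.
Qed.

(** The mean value theorem on each coordinate replaces the increment of [f] by
    a value of its Jacobian on the segment, and the Jacobian is continuous. *)
Lemma strict_differentiability f (U : set V) x (e : R) :
  open U -> U x -> (forall y, U y -> differentiable f y) ->
  {for x, continuous (jacobian f)} -> 0 < e ->
  exists2 r : R, 0 < r & forall u v, enorm (u - x) < r -> enorm (v - x) < r ->
    enorm (f u - f v - 'd f x (u - v)) <= e * enorm (u - v).
Proof.
move=> Uopen Ux df Jx e0.
have dxE w : 'd f x w = w *m jacobian f x.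
  by rewrite -deriveE ?deriveEjacobian//; exact: df.
pose e1 := e / (n.+1%:R * n.+1%:R).
have e10 : 0 < e1 by rewrite divr_gt0// mulr_gt0.
have /nbhs_enorm[r1 r10 UB] : nbhs x U by exact: open_nbhs_nbhs.
have /nbhs_enorm[r2 r20 JB] : nbhs x [set y | `|jacobian f x - jacobian f y| < e1].
  by move/cvgrPdist_lt : Jx; exact.
exists (Num.min r1 r2); first by rewrite lt_min r10.
move=> u v ur vr.
have seg t : 0 <= t <= 1 -> enorm (v + t *: (u - v) - x) < Num.min r1 r2.
  by move=> t01; exact: segment_enorm.
have dfs t : 0 <= t <= 1 -> differentiable f (v + t *: (u - v)).
  by move=> /seg; rewrite lt_min => /andP[? _]; exact/df/UB.
apply: le_trans (enorm_le_normr _) _.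
rewrite -ler_pdivlMl// [leLHS]/Num.Def.normr/= mx_normrE.
have w0 : 0 <= n.+1%:R^-1 * (e * enorm (u - v)).
  by rewrite mulr_ge0// ?invr_ge0// mulr_ge0 ?enorm_ge0// ltW.
apply: bigmax_le => // -[i j] _ /=; rewrite ord1 => {i}.
have [t t01 tE] := mean_value_coord j dfs.
have := JB _ (le_lt_trans (lexx _) (lt_le_trans (seg _ t01) _)).
rewrite ge_min lexx orbT => /(_ isT) Jt.
set c := v + t *: (u - v) in tE Jt.
have -> : (f u - f v - 'd f x (u - v)) 0 j =
    ((u - v) *m (jacobian f c - jacobian f x)) 0 j.
  by rewrite mulmxBr 3!mxE [in RHS]mxE dxE -tE; congr (_ + _); rewrite mxE.
rewrite mxE; apply: le_trans (ler_norm_sum _ _ _) _.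
apply: (@le_trans _ _ (\sum_(k < n) enorm (u - v) * e1)).
  apply: ler_sum => k _; rewrite normrM ler_pM// ?coord_le_enorm//.
  apply: le_trans (ltW Jt); rewrite distrC.
  rewrite [leRHS]/Num.Def.normr/= mx_normrE.
  exact: (le_bigmax _ (fun ij : 'I_n * 'I_n =>
    `|(jacobian f c - jacobian f x) ij.1 ij.2|) (k, j)).
rewrite sumr_const card_ord -[leLHS]mulr_natl /e1.
have n0 : (n.+1%:R : R) != 0 by rewrite pnatr_eq0.
have -> : n%:R * (enorm (u - v) * (e / (n.+1%:R * n.+1%:R))) =
   (n%:R / n.+1%:R) * (n.+1%:R^-1 * (e * enorm (u - v))).
  by rewrite invfM; ring.
by rewrite ler_piMl// ler_pdivrMr// mul1r ler_nat.
Qed.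

End StrictDifferentiability.

(** * Conformal maps on a compact set *)

Section Conformal.
Context {R : realType} {n : nat}.
Local Notation V := 'rV[R]_n.
Implicit Types (X : set V) (f : V -> V) (a b c d u v x y : V).

(** A conformal map is at small scales a similarity up to a factor close to 1:
    this is strict differentiability, the differential being a similarity. *)
Lemma conformal_near_similarity X f x (e : R) : conformal_on X f -> X x -> 0 < e ->
  exists2 s : R, 0 < s & exists2 r : R, 0 < r &
    forall u v, enorm (u - x) < r -> enorm (v - x) < r ->
      (1 - e) * s * enorm (u - v) <= enorm (f u - f v) <=
      (1 + e) * s * enorm (u - v).
Proof.
move=> [U [Uopen XU finj df simf]] Xx e0.
have Ux := XU _ Xx; have [s s0 sE] := simf _ Ux.
have [|||r r0 rB] := @strict_differentiability R n f U x (e * s) Uopen Ux.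
- by move=> y /df[].
- by have [] := df _ Ux.
- exact: mulr_gt0.
exists s => //; exists r => // u v ur vr; have := rB u v ur vr.
set w := f u - f v - _ => wle.
have fE : f u - f v = 'd f x (u - v) + w by rewrite /w [RHS]addrC subrK.
apply/andP; split.
  have := enormD_ge ('d f x (u - v)) w; rewrite -fE sE; nra.
by have := enormD ('d f x (u - v)) w; rewrite -fE sE; nra.
Qed.

(** The covering form of compactness: the threshold for [t] may depend on the point of
    [X] in the hypothesis, and does not in the conclusion. *)
Lemma compact_uniform_radius X (P : R -> V -> Prop) : compact X ->
  (forall x, X x -> exists2 r : R, 0 < r &
     forall y t, enorm (y - x) < r -> 0 < t < r -> P t y) ->
  exists2 t : R, 0 < t & forall y, X y -> P t y.
Proof.
move=> /compact_near_coveringP Xc PX.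
have : \forall t \near (0 : R)^'+, X `<=` P t.
  apply: (Xc R (0 : R)^'+ P) => x /PX[r r0 rP].
  exists ([set y | enorm (y - x) < r], [set t | 0 < t < r]) => /=.
    split; first by apply/nbhs_enorm; exists r.
    by near=> t; apply/andP; split; near: t; [exact: nbhs_right_gt|exact: nbhs_right_lt].
  by move=> [y t] /= [yx t0]; exact: rP.
move=> XP; have [t [t0 tP]] : exists t : R, 0 < t /\ X `<=` P t.
  near (0 : R)^'+ => t; exists t; split; first by near: t; exact: nbhs_right_gt.
  by near: t.
by exists t.
Unshelve. all: by end_near. Qed.

Lemma conformal_continuous X f x : conformal_on X f -> X x -> {for x, continuous f}.
Proof.
by move=> [U [_ XU _ df _]] /XU /df[dfx _]; exact: differentiable_continuous.
Qed.

(** Near a point the map is nearly a similarity, so it changes all distances by nearly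
    the same factor; compactness makes the scale uniform. *)
Lemma conformal_small_distortion X f (e : R) : compact X -> conformal_on X f -> 0 < e ->
  exists2 r : R, 0 < r & forall a b c d, X a -> X b -> X c -> X d ->
    enorm (b - a) < r -> enorm (c - a) < r -> enorm (d - a) < r ->
    enorm (f a - f b) * enorm (c - d) <= (1 + e) * enorm (f c - f d) * enorm (a - b).
Proof.
move=> Xc fconf e0.
pose P (r : R) a := forall b c d,
    enorm (b - a) < r -> enorm (c - a) < r -> enorm (d - a) < r ->
    enorm (f a - f b) * enorm (c - d) <= (1 + e) * enorm (f c - f d) * enorm (a - b).
suff [r r0 rP] : exists2 r : R, 0 < r & forall a, X a -> P r a.
  by exists r => // a b c d Xa _ _ _; exact: rP.
apply: compact_uniform_radius => // x Xx.
(* The solution of (1 + d) / (1 - d) = 1 + e. *)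
pose d := e / (2 + e).
have d0 : 0 < d by rewrite divr_gt0// addr_gt0.
have dE : 1 + d = (1 + e) * (1 - d) by rewrite /d; field; lra.
have d1 : 0 < 1 - d by rewrite subr_gt0 ltr_pdivrMr; lra.
have [s s0 [r r0 rB]] := conformal_near_similarity fconf Xx d0.
exists (r / 2) => [|a t ax /andP[t0 tr] b c b' ba ca b'a]; first by rewrite divr_gt0.
have near_x v : enorm (v - a) < t -> enorm (v - x) < r.
  by move=> va; rewrite (le_lt_trans (enorm_dist _ a _))//; lra.
have ar : enorm (a - x) < r by lra.
have /andP[_ ab] := rB _ _ ar (near_x _ ba).
have /andP[cd _] := rB _ _ (near_x _ ca) (near_x _ b'a).
apply: (@le_trans _ _ ((1 + d) * s * enorm (a - b) * enorm (c - b'))).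
  by rewrite ler_wpM2r// enorm_ge0.
rewrite dE [leLHS](_ : _ = (1 + e) * ((1 - d) * s * enorm (c - b')) * enorm (a - b)).
  by rewrite ler_wpM2r ?enorm_ge0// ler_wpM2l//; lra.
by ring.
Qed.

Lemma compact_uniform_radius2 X (P : R -> V -> V -> Prop) : compact X ->
  (forall x y, X x -> X y -> exists2 r : R, 0 < r &
     forall x' y' t, enorm (x' - x) < r -> enorm (y' - y) < r -> 0 < t < r ->
       P t x' y') ->
  exists2 t : R, 0 < t & forall x y, X x -> X y -> P t x y.
Proof.
move=> Xc PX.
have step x : X x -> exists2 r : R, 0 < r & forall y, X y -> forall x' t,
    enorm (x' - x) < r -> 0 < t < r -> P t x' y.
  move=> Xx.
  have := @compact_uniform_radius X (fun r y => forall x' t,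
    enorm (x' - x) < r -> 0 < t < r -> P t x' y) Xc.
  apply=> y Xy; have [r r0 rP] := PX x y Xx Xy.
  exists r => // y' t y'y /andP[t0 tr] x' t' x'x /andP[t'0 t't].
  by apply: rP => //; rewrite ?(lt_trans x'x)// t'0 (lt_trans t't).
have [x Xx|t t0 tP] := @compact_uniform_radius X (fun t x => forall y, X y -> P t x y) Xc.
  have [r r0 rP] := step x Xx; exists r => // x' t x'x tr y Xy.
  exact: rP.
by exists t => // x y Xx Xy; exact: tP.
Qed.

(** Close points are separated by near similarity, distant ones by injectivity
    and compactness. *)
Lemma conformal_lower_lipschitz X f : compact X -> conformal_on X f ->
  exists2 k : R, 0 < k & forall x y, X x -> X y ->
    k * enorm (x - y) <= enorm (f x - f y).
Proof.
move=> Xc fconf.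
apply: (@compact_uniform_radius2 X (fun k x y =>
  k * enorm (x - y) <= enorm (f x - f y)) Xc) => x y Xx Xy.
have [<-{y Xy}|xy] := eqVneq x y.
  have h0 : 0 < 2^-1 :> R by rewrite invr_gt0.
  have [s s0 [r r0 rB]] := conformal_near_similarity fconf Xx h0.
  exists (Num.min r (s / 2)); first by rewrite lt_min r0 divr_gt0.
  move=> u v t; rewrite !lt_min => /andP[ur _] /andP[vr _] /andP[t0 /andP[_ ts]].
  have /andP[+ _] := rB u v ur vr; apply: le_trans.
  by rewrite ler_wpM2r ?enorm_ge0//; lra.
have fxy : 0 < enorm (f x - f y).
  rewrite lt0r enorm_ge0 andbT enorm_eq0 subr_eq0.
  apply: contra_neq xy; have [U [_ XU finj _ _]] := fconf.
  by apply: finj; exact: XU.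
set h := enorm (f x - f y) in fxy.
have near_f z : X z -> exists2 r : R, 0 < r &
    forall u, enorm (u - z) < r -> enorm (f u - f z) < h / 4.
  move=> Xz; apply/(@nbhs_enorm _ _ z [set u | enorm (f u - f z) < h / 4]).
  have fz := conformal_continuous fconf Xz.
  apply: (fz [set v | enorm (v - f z) < h / 4]).
  by apply/nbhs_enorm; exists (h / 4) => //; rewrite divr_gt0.
have [r1 r10 B1] := near_f _ Xx; have [r2 r20 B2] := near_f _ Xy.
pose D := enorm (x - y) + 2; have D0 : 0 < D by have := enorm_ge0 (x - y); rewrite /D; lra.
exists (Num.min (Num.min r1 r2) (Num.min 1 (h / 2 / D))).
  by rewrite !lt_min r10 r20 ltr01 !divr_gt0.
move=> u v t; rewrite !lt_min.
move=> /andP[/andP[/B1 u1 _] /andP[u3 _]] /andP[/andP[_ /B2 v2] /andP[v3 _]].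
move=> /andP[t0 /andP[_ /andP[_ tD]]].
have uv : enorm (u - v) <= D.
  have := enorm_dist u x v; have := enorm_dist x y v.
  by rewrite (enormB y v) /D; lra.
have tD' : t * D < h / 2 by rewrite -ltr_pdivlMr.
have : t * enorm (u - v) <= t * D by rewrite ler_wpM2l// ltW.
have := enorm_dist (f x) (f u) (f y); have := enorm_dist (f u) (f v) (f y).
rewrite (enormB (f x) (f u)) -/h; lra.
Qed.

End Conformal.

(** * Compositions along words *)

(** The starting symbol is kept apart, as in [path], so that the concatenation of words
    becomes the composition of maps ([chain_cat]). *)
Fixpoint chain {T : Type} {V : Type} (ff : T -> T -> V -> V) (a : T) (w : seq T) : V -> V :=
  if w is b :: w' then ff a b \o chain ff b w' else id.

(** The metric properties of a conformal graph directed system on which the proof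
    rests, uniformly in the edges.  The last one stands in for the bounded distortion
    principle: on sets of small diameter a map changes all the distances by nearly the
    same factor. *)
Record asymptotically_conformal {R : realType} {n : nat} {T : Type}
    (X : set 'rV[R]_n) (e : rel T) (ff : T -> T -> 'rV[R]_n -> 'rV[R]_n) (c k D : R) := {
  ac_contraction_range : 0 < c < 1;
  ac_lower_range : 0 < k <= 1;
  ac_diam_gt0 : 0 < D;
  ac_diam : forall x y, X x -> X y -> enorm (x - y) <= D;
  ac_maps : forall i j x, e i j -> X x -> X (ff i j x);
  ac_contraction : forall i j x y, e i j -> X x -> X y ->
    enorm (ff i j x - ff i j y) <= c * enorm (x - y);
  ac_lower : forall i j x y, e i j -> X x -> X y ->
    k * enorm (x - y) <= enorm (ff i j x - ff i j y);
  ac_distortion : forall d : R, 0 < d -> exists2 r : R, 0 < r &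
    forall i j x y z t, e i j -> X x -> X y -> X z -> X t ->
    enorm (y - x) < r -> enorm (z - x) < r -> enorm (t - x) < r ->
    enorm (ff i j x - ff i j y) * enorm (z - t) <=
      (1 + d) * enorm (ff i j z - ff i j t) * enorm (x - y)
}.

Definition image_diam {R : realType} {n : nat} (X : set 'rV[R]_n)
    (F : 'rV[R]_n -> 'rV[R]_n) : R :=
  sup [set enorm (F p.1 - F p.2) | p in X `*` X].

Lemma geometric_small {R : realType} (c D r : R) : 0 < c < 1 -> 0 <= D -> 0 < r ->
  exists K, forall k, (K <= k)%N -> c ^+ k * D < r.
Proof.
move=> /andP[c0 c1] D0 r0.
have : (fun k => c ^+ k) @ \oo --> (0 : R) by apply: cvg_expr; rewrite gtr0_norm.
move/cvgrPdist_lt => /(_ (r / (D + 1))); rewrite divr_gt0 ?ltr_wpDl// => /(_ isT)[K _ KP].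
exists K => k Kk; have := KP k Kk.
rewrite /= sub0r normrN ger0_norm ?exprn_ge0 ?ltW// ltr_pdivlMr ?ltr_wpDl//.
by apply: le_lt_trans; rewrite ler_wpM2l ?exprn_ge0 ?lerDl// ltW.
Qed.

Section Chains.
Context {R : realType} {n : nat} {T : Type}.
Context {X : set 'rV[R]_n} {e : rel T} {ff : T -> T -> 'rV[R]_n -> 'rV[R]_n} {c k D : R}.
Context (S : asymptotically_conformal X e ff c k D).
Implicit Types (a : T) (u v w : seq T) (x y z t : 'rV[R]_n).
Local Notation F := (chain ff).

Lemma chain_cat a u v x : F a (u ++ v) x = F a u (F (last a u) v x).
Proof. by elim: u a => //= b u IH a; rewrite IH. Qed.

Lemma chain_maps a w x : path e a w -> X x -> X (F a w x).
Proof.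
elim: w a => //= b w IH a /andP[ab bw] Xx.
exact: (ac_maps S ab (IH _ bw Xx)).
Qed.

Lemma chain_contraction a w x y : path e a w -> X x -> X y ->
  enorm (F a w x - F a w y) <= c ^+ size w * enorm (x - y).
Proof.
have /andP[c0 _] := ac_contraction_range S.
elim: w a => [a _ _ _|b w IH a /= /andP[ab bw] Xx Xy]; first by rewrite mul1r.
have := ac_contraction S ab (chain_maps bw Xx) (chain_maps bw Xy).
move/le_trans; apply; rewrite exprS -mulrA ler_wpM2l ?IH//; exact: ltW.
Qed.

Lemma chain_lower a w x y : path e a w -> X x -> X y ->
  k ^+ size w * enorm (x - y) <= enorm (F a w x - F a w y).
Proof.
have /andP[k0 _] := ac_lower_range S.
elim: w a => [a _ _ _|b w IH a /= /andP[ab bw] Xx Xy]; first by rewrite mul1r.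
apply: le_trans (ac_lower S ab (chain_maps bw Xx) (chain_maps bw Xy)).
by rewrite exprS -mulrA ler_wpM2l ?IH//; exact: ltW.
Qed.

Lemma chain_inj a w x y : path e a w -> X x -> X y -> F a w x = F a w y -> x = y.
Proof.
move=> aw Xx Xy Fxy; have := chain_lower aw Xx Xy.
rewrite Fxy subrr (_ : enorm 0 = 0); last by apply/eqP; rewrite enorm_eq0.
have /andP[k0 _] := ac_lower_range S.
rewrite pmulr_rle0 ?exprn_gt0// => xy.
by apply/eqP; rewrite -subr_eq0 -enorm_eq0 eq_le xy enorm_ge0.
Qed.

Lemma chain_contraction1 a w x y : path e a w -> X x -> X y ->
  enorm (F a w x - F a w y) <= enorm (x - y).
Proof.
move=> aw Xx Xy; apply: le_trans (chain_contraction aw Xx Xy) _.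
have /andP[c0 c1] := ac_contraction_range S.
by rewrite ler_piMl ?enorm_ge0// exprn_ile1// ltW.
Qed.

(** The factors [1 + d] multiply, since the images of a small set remain small.
    Cancelling a distance between images uses injectivity. *)
Lemma chain_small_distortion (d r : R) : 0 < d ->
  (forall i j x y z t, e i j -> X x -> X y -> X z -> X t ->
    enorm (y - x) < r -> enorm (z - x) < r -> enorm (t - x) < r ->
    enorm (ff i j x - ff i j y) * enorm (z - t) <=
      (1 + d) * enorm (ff i j z - ff i j t) * enorm (x - y)) ->
  forall a w x y z t, path e a w -> X x -> X y -> X z -> X t ->
    enorm (y - x) < r -> enorm (z - x) < r -> enorm (t - x) < r ->
    enorm (F a w x - F a w y) * enorm (z - t) <=
      (1 + d) ^+ size w * enorm (F a w z - F a w t) * enorm (x - y).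
Proof.
move=> d0 rP a w x y z t + Xx Xy Xz Xt yx zx tx.
elim: w a => [a _|b w IH a /= /andP[ab bw]]; first by rewrite mul1r mulrC.
have [zt|zt] := eqVneq (enorm (z - t)) 0.
  rewrite zt mulr0 !mulr_ge0 ?enorm_ge0// exprn_ge0//; lra.
have [x' y' z' t'] : [/\ X (F b w x), X (F b w y), X (F b w z) & X (F b w t)].
  by split; exact: chain_maps.
have sm p p' : X p -> X p' -> enorm (p - p') < r -> enorm (F b w p - F b w p') < r.
  by move=> Xp Xp'; apply: le_lt_trans; exact: chain_contraction1.
have := rP _ _ _ _ _ _ ab x' y' z' t' (sm _ _ Xy Xx yx) (sm _ _ Xz Xx zx) (sm _ _ Xt Xx tx).
have := IH _ bw.
have : 0 < enorm (F b w z - F b w t).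
  rewrite lt0r enorm_ge0 andbT enorm_eq0 subr_eq0.
  by apply: contra_neq zt => /(chain_inj bw Xz Xt) ->; apply/eqP; rewrite enorm_eq0 subrr.
rewrite exprS.
set p := enorm (F b w z - _); set p' := enorm (F b w x - _).
set Q := enorm (ff a b _ - _); set Q' := enorm (ff a b (F b w z) - _).
move: (enorm (z - t)) (enorm_ge0 (z - t)) (enorm (x - y)) ((1 + d) ^+ size w) => m m0 m' C.
have Q'0 : 0 <= Q' by exact: enorm_ge0.
move=> p0 IHw rw; rewrite -(ler_pM2r p0).
apply: (@le_trans _ _ ((1 + d) * Q' * (p' * m))).
  by rewrite mulrAC mulrA ler_wpM2r.
apply: (@le_trans _ _ ((1 + d) * Q' * (C * p * m'))).
  by rewrite ler_wpM2l// mulr_ge0//; lra.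
by rewrite le_eqVlt; apply/orP; left; apply/eqP; ring.
Qed.

(** The innermost [K] maps, [K] depending only on [d], bring [X] down to a set so
    small that every later map distorts it by a factor at most [1 + d]. *)
Lemma chain_distortion (d : R) : 0 < d -> exists2 C : R, 0 < C &
  forall a w x y z t, path e a w -> X x -> X y -> X z -> X t ->
    C * enorm (F a w z - F a w t) * enorm (x - y) <=
      (1 + d) ^+ size w * enorm (F a w x - F a w y).
Proof.
move=> d0; have [r r0 rP] := ac_distortion S d0.
have /andP[c0 c1] := ac_contraction_range S.
have /andP[k0 k1] := ac_lower_range S.
have D0 := ac_diam_gt0 S; have XD := ac_diam S.
have [K cK] : exists K, c ^+ K * D < r.
  have [K KP] := geometric_small (ac_contraction_range S) (ltW D0) r0.
  by exists K; exact: KP.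
exists (k ^+ K / D); first by rewrite divr_gt0// exprn_gt0.
move=> a w x y z t aw Xx Xy Xz Xt.
have [wK|Kw] := leqP (size w) K.
  have dw : 1 <= (1 + d) ^+ size w by rewrite exprn_ege1//; lra.
  apply: (@le_trans _ _ (1 * enorm (F a w x - F a w y))); last first.
    by rewrite ler_wpM2r// enorm_ge0.
  rewrite mul1r; apply: le_trans (chain_lower aw Xx Xy).
  rewrite ler_wpM2r ?enorm_ge0// mulrAC ler_pdivrMr//.
  rewrite ler_pM ?exprn_ge0 ?enorm_ge0 ?(ltW k0)//.
    by rewrite ler_wiXn2l// ltW.
  apply: le_trans (chain_contraction1 aw Xz Xt) _; exact: XD.
pose u := take (size w - K) w; pose v := drop (size w - K) w.
have wE : w = u ++ v by rewrite cat_take_drop.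
have vK : size v = K by rewrite size_drop subKn// ltnW.
have [au lv] : path e a u /\ path e (last a u) v.
  by apply/andP; rewrite -cat_path -wE.
have [x' y' z' t'] : [/\ X (F (last a u) v x), X (F (last a u) v y),
    X (F (last a u) v z) & X (F (last a u) v t)] by split; exact: chain_maps.
have sm p p' : X p -> X p' -> enorm (F (last a u) v p - F (last a u) v p') < r.
  move=> Xp Xp'; apply: le_lt_trans (chain_contraction lv Xp Xp') _.
  by rewrite vK; apply: le_lt_trans cK; rewrite ler_wpM2l ?exprn_ge0 ?XD// ltW.
have := chain_small_distortion d0 rP au z' t' x' y'
  (sm _ _ Xt Xz) (sm _ _ Xx Xz) (sm _ _ Xy Xz).
rewrite -!chain_cat -wE => FF.
have low := chain_lower lv Xx Xy; rewrite vK in low.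
have up : enorm (F (last a u) v z - F (last a u) v t) <= D by exact: XD.
have dd : (1 + d) ^+ size u <= (1 + d) ^+ size w.
  by rewrite ler_weXn2l// ?wE ?size_cat ?leq_addr//; lra.
have Fzt := enorm_ge0 (F a w z - F a w t); have Fxy := enorm_ge0 (F a w x - F a w y).
rewrite -mulrA mulrAC ler_pdivrMr//.
apply: (@le_trans _ _ (enorm (F a w z - F a w t) * (k ^+ K * enorm (x - y)))).
  by rewrite le_eqVlt; apply/orP; left; apply/eqP; ring.
apply: le_trans (ler_wpM2l Fzt low) _; apply: le_trans FF _.
apply: ler_pM => //; rewrite ?mulr_ge0 ?enorm_ge0// ?exprn_ge0//; try lra.
by rewrite ler_wpM2r.
Qed.

Lemma image_diam_ub a w x y : path e a w -> X x -> X y ->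
  enorm (F a w x - F a w y) <= image_diam X (F a w).
Proof.
move=> aw Xx Xy; apply: ub_le_sup; last by exists (x, y).
exists D => _ [[p p'] [/= Xp Xp'] <-].
apply: le_trans (chain_contraction1 aw Xp Xp') _; exact: (ac_diam S).
Qed.

Lemma image_diam_le a w (r : R) : X !=set0 ->
  (forall x y, X x -> X y -> enorm (F a w x - F a w y) <= r) ->
  image_diam X (F a w) <= r.
Proof.
move=> [x Xx] h; apply: ge_sup; first by exists (enorm (F a w x - F a w x)), (x, x).
by move=> _ [[p p'] [/= Xp Xp'] <-]; exact: h.
Qed.

Lemma image_diam_ge0 a w : X !=set0 -> path e a w -> 0 <= image_diam X (F a w).
Proof.
by move=> [x Xx] aw; apply: le_trans (image_diam_ub aw Xx Xx); exact: enorm_ge0.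
Qed.

Lemma image_diam_expr a w : X !=set0 -> path e a w ->
  image_diam X (F a w) <= c ^+ size w * D.
Proof.
have /andP[c0 _] := ac_contraction_range S.
move=> X0 aw; apply: image_diam_le => // x y Xx Xy.
apply: le_trans (chain_contraction aw Xx Xy) _.
by rewrite ler_wpM2l ?(ac_diam S)// exprn_ge0// ltW.
Qed.

(** The smallest dilation of the map along a word is as large as the diameter of its
    image, up to a factor that is exponential with an arbitrarily small rate. *)
Lemma chain_lower_diam (d : R) : X !=set0 -> 0 < d -> exists2 C : R, 0 < C &
  forall a w x y, path e a w -> X x -> X y ->
    C * (1 + d) ^- size w * image_diam X (F a w) * enorm (x - y) <=
      enorm (F a w x - F a w y).
Proof.
move=> X0 d0; have [C C0 CP] := chain_distortion d0.
exists C => // a w x y aw Xx Xy.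
have dw : 0 < (1 + d) ^+ size w by rewrite exprn_gt0//; lra.
have [->|xy] := eqVneq (enorm (x - y)) 0; first by rewrite mulr0 enorm_ge0.
have {}xy : 0 < enorm (x - y) by rewrite lt0r xy enorm_ge0.
rewrite -ler_pdivlMr// -ler_pdivlMl; last by rewrite divr_gt0.
apply: image_diam_le => // z t Xz Xt.
rewrite ler_pdivlMl ?divr_gt0// ler_pdivlMr// mulrAC mulrAC.
have := CP a w x y z t aw Xx Xy Xz Xt.
rewrite -ler_pdivrMl// => /(le_trans _); apply.
by rewrite le_eqVlt; apply/orP; left; apply/eqP; ring.
Qed.

End Chains.

(** * The shift space and ergodic sums *)

Section Symbolic.
Context {q : nat}.
Implicit Types (s t : symbolic_space q) (A : 'M[bool]_q).

Definition agree (k : nat) s t := forall j, (j < k)%N -> s j = t j.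

Lemma iter_shiftE k s j : iter k shift s j = s (k + j)%N.
Proof. by elim: k j => // k IH j; rewrite iterS /shift IH addSnnS. Qed.

Lemma iter_shift_agree k m s t :
  agree (k + m) s t -> agree m (iter k shift s) (iter k shift t).
Proof. by move=> st j jm; rewrite !iter_shiftE st// ltn_add2l. Qed.

Lemma SFT_iter_shift A k s : SFT A s -> SFT A (iter k shift s).
Proof. by move=> As j; rewrite !iter_shiftE addnS; exact: As. Qed.

Lemma nbhs_agree s k : nbhs s [set t | agree k s t].
Proof.
elim: k => [|k IH]; first by apply: filterS filterT => t _ j.
have sk : nbhs s [set t : symbolic_space q | t k = s k].
  have pc := @proj_continuous nat (fun=> discrete_topology 'I_q) k s.
  apply: (pc [set s k]).
  exact/principal_filterP.
apply: filterS (filterI IH sk) => t /= [st tk] j.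
by rewrite ltnS leq_eqVlt => /orP[/eqP->|/st].
Qed.

(** The filter generated by the cylinders around [s] converges to [s] in each
    coordinate, hence in the product topology. *)
Lemma nbhs_agree_base s (W : set (symbolic_space q)) :
  nbhs s W -> exists k, [set t | agree k s t] `<=` W.
Proof.
pose F : set_system (symbolic_space q) :=
  [set B | exists k, [set t | agree k s t] `<=` B].
have FF : Filter F.
  split; first by exists 0%N.
    move=> P Q [k kP] [l lQ]; exists (maxn k l) => t /= st; split.
      by apply: kP => j jk; apply: st; rewrite leq_max jk.
    by apply: lQ => j jl; apply: st; rewrite leq_max jl orbT.
  by move=> P Q PQ [k kP]; exists k => t /kP /PQ.
suff : F --> s by exact.
apply/cvg_sup => N U [V] [[B] oB <-] BsN BU.
by exists N.+1 => t st; apply: BU; rewrite /= -(st N).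
Qed.

Lemma compact_SFT A : compact (SFT A).
Proof.
have full : compact [set: symbolic_space q].
  have := @tychonoff nat (fun=> discrete_topology 'I_q) (fun=> setT).
  rewrite (_ : [set f | _] = setT); last by apply/seteqP; split.
  apply=> i; apply: finite_compact.
  exact: (@finite_finset 'I_q).
apply: (subclosed_compact _ full) => //.
move=> s sA k.
have [t [At st]] := sA _ (nbhs_agree s k.+2).
by rewrite !st//; exact: At.
Qed.

End Symbolic.

Section Observables.
Context {R : realType} {q : nat} {A : 'M[bool]_q} {g : symbolic_space q -> R}.
Context (gcont : {within SFT A, continuous g}).
Implicit Types (s t : symbolic_space q).

Lemma observable_bounded : exists2 G : R, 0 < G & forall s, SFT A s -> `|g s| <= G.
Proof.
have /compact_bounded[M [Mreal MP]] := continuous_compact gcont (@compact_SFT q A).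
exists (Num.max M 0 + 1); first by rewrite ltr_wpDl// le_max lexx orbT.
move=> s As; apply: (MP (Num.max M 0 + 1)); last by exists s.
by rewrite ltr_pwDr// le_max lexx.
Qed.

Lemma observable_uniform (e : R) : 0 < e ->
  exists k, forall s t, SFT A s -> SFT A t -> agree k s t -> `|g s - g t| < e.
Proof.
move=> e0.
have := @compact_SFT q A; move=> /compact_near_coveringP/near_covering_withinP.
move=> /(_ nat \oo (fun k s => forall t, SFT A t -> agree k s t -> `|g s - g t| < e)).
case => [s As|k _ kP].
  have := @gcont s.
  move/cvgrPdist_lt => /(_ (e / 2)); rewrite divr_gt0// => /(_ isT).
  move=> near_s.
  have : within (SFT A) (nbhs s) [set t | `|g s - g t| < e / 2].
    by rewrite nbhs_subspace_in.
  move=> /nbhs_agree_base[k kP].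
  have gs t : SFT A t -> agree k s t -> `|g s - g t| < e / 2.
    by move=> At st; exact: (kP _ st At).
  exists ([set t | agree k s t], [set j | (k <= j)%N]) => /=.
    by split; [exact: nbhs_agree|exists k].
  move=> [s' j] /= [ss' kj] As' t At s't.
  have st : agree k s t by move=> i ik; rewrite ss'// s't// (leq_trans ik).
  have := gs _ As' ss'; have := gs _ At st.
  have := ler_distD (g s) (g s') (g t); rewrite (distrC (g s') (g s)); lra.
by exists k => s t As; apply: kP => //=.
Qed.

Definition birkhoff (h : symbolic_space q -> R) s (N : nat) : R :=
  \sum_(k < N) h (iter k shift s).

Lemma birkhoffS h s N : birkhoff h s N.+1 = h s + birkhoff h (shift s) N.
Proof.
by rewrite /birkhoff big_ord_recl; congr (_ + _); apply: eq_bigr => i _; rewrite /= -iterSr.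
Qed.

Lemma birkhoffD h s M N :
  birkhoff h s (M + N) = birkhoff h s M + birkhoff h (iter M shift s) N.
Proof.
elim: M s => [|M IH] s; first by rewrite /birkhoff big_ord0 add0r.
by rewrite addSn !birkhoffS IH -addrA -iterSr.
Qed.

(** Only the last [k] terms can differ by more than [e], where agreement on [k] symbols
    makes the values of the observable [e]-close. *)
Lemma birkhoff_agree (e : R) : 0 < e -> exists2 B : R, 0 < B &
  forall N s t, SFT A s -> SFT A t -> agree N s t ->
    `|birkhoff g s N - birkhoff g t N| <= N%:R * e + B.
Proof.
move=> e0; have [G G0 GP] := observable_bounded.
have [k kP] := observable_uniform e0.
exists (k.+1%:R * (2 * G)) => [|N s t As At st]; first by rewrite !mulr_gt0.
suff : `|birkhoff g s N - birkhoff g t N| <= N%:R * e + (minn N k)%:R * (2 * G).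
  move/le_trans; apply; rewrite lerD2l ler_wpM2r//; first lra.
  by rewrite ler_nat (leq_trans (geq_minr _ _)).
elim: N s t As At st => [|N IH] s t As At st.
  by rewrite /birkhoff !big_ord0 subr0 normr0 !mul0r add0r min0n mul0r.
have {}IH := IH (shift s) (shift t) (@SFT_iter_shift _ A 1 s As)
  (@SFT_iter_shift _ A 1 t At) (@iter_shift_agree _ 1 N s t st).
rewrite !birkhoffS (_ : _ - _ = (g s - g t) +
  (birkhoff g (shift s) N - birkhoff g (shift t) N)); last by ring.
apply: le_trans (ler_normD _ _) _.
have [kN|Nk] := leqP k N.+1.
  have gst : `|g s - g t| < e.
    by apply: kP => // j jk; apply: st; exact: leq_trans kN.

  have : (minn N k)%:R <= (k%:R : R) by rewrite ler_nat geq_minr.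
  rewrite -natr1; nra.

have minN : minn N k = N by apply/minn_idPl/ltnW/ltnW.
rewrite minN in IH; rewrite -natr1.
have := GP _ As; have := GP _ At; have := ler_normB (g s) (g t); nra.
Qed.

Lemma birkhoff_bounded (G : R) s N : (forall t, SFT A t -> `|g t| <= G) -> SFT A s ->
  `|birkhoff g s N| <= N%:R * G.
Proof.
move=> GP As; apply: le_trans (ler_norm_sum _ _ _) _.
rewrite mulr_natl -[N in leRHS]card_ord -sumr_const; apply: ler_sum => i _.
exact/GP/SFT_iter_shift.
Qed.

End Observables.

(** * Coding of the limit set *)

Definition edge {q : nat} (A : 'M[bool]_q) : rel 'I_q := fun i j => `[< occurs A i j >].

Definition occurring {q : nat} (A : 'M[bool]_q) (a : 'I_q) :=
  exists2 s, SFT A s & s 0%N = a.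

Section Coding.
Context {R : realType} {n q : nat}.
Local Notation V := 'rV[R]_n.
Context {A : 'M[bool]_q}.
Implicit Types (s t : symbolic_space q).

(** The symbol [s 0] is left out because it is the starting point of a [path] with [N]
    edges. *)
Definition initial_word s (N : nat) : seq 'I_q := mkseq (fun k => s k.+1) N.

Lemma size_initial_word s N : size (initial_word s N) = N.
Proof. by rewrite size_mkseq. Qed.

Lemma initial_wordS s N : initial_word s N.+1 = rcons (initial_word s N) (s N.+1).
Proof. by rewrite /initial_word mkseqS. Qed.

Lemma last_initial_word s N : last (s 0%N) (initial_word s N) = s N.
Proof. by case: N => [|N] //; rewrite initial_wordS last_rcons. Qed.

Lemma initial_word_path s N : SFT A s -> path (edge A) (s 0%N) (initial_word s N).
Proof.
move=> As; elim: N => // N IH.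
rewrite initial_wordS rcons_path IH last_initial_word.
by apply/asboolP; exists s => //; exists N.
Qed.

Lemma initial_wordD s M N :
  initial_word s (M + N) = initial_word s M ++ initial_word (iter M shift s) N.
Proof.
elim: N => [|N IH]; first by rewrite addn0 cats0.
by rewrite addnS !initial_wordS IH rcons_cat iter_shiftE addnS.
Qed.

Lemma nth_initial_word s N (a : 'I_q) k : (k <= N)%N ->
  nth a (s 0%N :: initial_word s N) k = s k.
Proof. by case: k => //= k kN; rewrite nth_mkseq. Qed.

Lemma occurring_connect (a b : 'I_q) : transitive_SFT A -> occurring A a -> occurring A b ->
  exists w, path (edge A) a w /\ last a w = b.
Proof.
move=> trA [s As sa] [t At tb].
have cyl_open (i : 'I_q) : open [set u : symbolic_space q | u 0%N = i].
  rewrite openE => u ui; apply: filterS (nbhs_agree u 1) => v uv /=.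
  by rewrite -(uv 0%N).
have [|k [u [[Au ua] ub]]] := trA _ _ (cyl_open a) (cyl_open b) (ex_intro _ s (conj As sa)).
  by exists t.
exists (initial_word u k); rewrite -ua; split; first exact: initial_word_path.
by rewrite last_initial_word; move: ub => /=; rewrite iter_shiftE addn0.
Qed.

Context {X : set V} {f : 'I_q -> V -> V} {ff : 'I_q -> 'I_q -> V -> V} {c k D : R}.
Context (X_compact : compact X) (X_nonempty : X !=set0).
Context (S : asymptotically_conformal X (edge A) ff c k D).
Context (f_contraction : forall i x y, X x -> X y ->
  enorm (f i x - f i y) <= enorm (x - y)).

Lemma word_mapE s N :
  word_map f ff s N = f (s 0%N) \o chain ff (s 0%N) (initial_word s N).
Proof.
elim: N => // N IH; rewrite initial_wordS -cats1.
apply/funext => x; rewrite [word_map f ff s N.+1]/= IH.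
rewrite [LHS]/= [RHS]/= (@chain_cat R n _ ff) last_initial_word.
by [].
Qed.

Lemma word_map_lipschitz s N x y : SFT A s -> X x -> X y ->
  enorm (word_map f ff s N x - word_map f ff s N y) <= c ^+ N * enorm (x - y).
Proof.
move=> As Xx Xy; rewrite word_mapE /=; have pw := initial_word_path N As.
apply: le_trans (f_contraction _ (chain_maps S pw Xx) (chain_maps S pw Xy)) _.
have := chain_contraction S pw Xx Xy.
by rewrite size_initial_word.
Qed.

Lemma word_map_nested s M N : SFT A s -> (M <= N)%N ->
  word_map f ff s N @` X `<=` word_map f ff s M @` X.
Proof.
move=> As /subnKC <- _ [x Xx <-].
exists (chain ff (s M) (initial_word (iter M shift s) (N - M)) x).
  apply: (chain_maps S) => //.
  have := initial_word_path (N - M) (SFT_iter_shift M As).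
  by rewrite iter_shiftE addn0.
by rewrite !word_mapE initial_wordD /= (@chain_cat R n _ ff) last_initial_word.
Qed.

Lemma compact_lipschitz_image (G : V -> V) :
  (forall x y, X x -> X y -> enorm (G x - G y) <= enorm (x - y)) -> compact (G @` X).
Proof.
move=> GL; apply: continuous_compact X_compact.
apply/subspace_continuousP => x Xx W /nbhs_enorm[r r0 rW].
apply/nbhs_enorm; exists r => // y yx Xy /=; apply: rW.
exact: le_lt_trans (GL _ _ Xy Xx) yx.
Qed.

Lemma word_map_compact s N : SFT A s -> compact (word_map f ff s N @` X).
Proof.
move=> As; apply: compact_lipschitz_image => x y Xx Xy.
apply: le_trans (word_map_lipschitz _ As Xx Xy) _.
have /andP[c0 c1] := ac_contraction_range S.
by rewrite ler_piMl ?enorm_ge0// exprn_ile1// ltW.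
Qed.

(** The images are nested compact sets with diameters that tend to 0. *)
Lemma coding_map_spec s : SFT A s ->
  \bigcap_k (word_map f ff s k @` X) = [set coding_map X f ff s].
Proof.
move=> As; rewrite /coding_map.
suff [z zE] : exists z, \bigcap_k (word_map f ff s k @` X) = [set z].
  have Pz : exists x, [set x | \bigcap_k (word_map f ff s k @` X) = [set x]] x by exists z.
  exact: (xgetPex 0 Pz).
have [p Xp] := X_nonempty.
have tail M : ((fun N => word_map f ff s N p) @ \oo) (word_map f ff s M @` X).
  by exists M => // N MN; apply: (word_map_nested As MN); exists p.
have K0 : compact (word_map f ff s 0 @` X) by exact: word_map_compact.
have [z [_ zcl]] := K0 ((fun N => word_map f ff s N p) @ \oo) _ (tail 0%N).
have zin N : (word_map f ff s N @` X) z.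
  have cl : closed (word_map f ff s N @` X).
    by apply: compact_closed; [exact: norm_hausdorff|exact: word_map_compact].
  by apply: cl => B Bz; exact: zcl.
exists z; apply/seteqP; split=> [y yin|_ -> N _]; last exact: zin.
have D0 : 0 <= D by exact/ltW/(ac_diam_gt0 S).
apply/eqP; rewrite -subr_eq0 -enorm_eq0 eq_le enorm_ge0 andbT leNgt; apply/negP => yz.
have [N NP] := geometric_small (ac_contraction_range S) D0 yz.
have := NP N (leqnn _); apply/negP; rewrite -leNgt.
have [x1 Xx1 <-] := yin N I; have [x2 Xx2 <-] := zin N.
apply: le_trans (word_map_lipschitz _ As Xx1 Xx2) _.
have /andP[c0 _] := ac_contraction_range S.
by rewrite ler_wpM2l ?exprn_ge0 ?(ltW c0)//; exact: (ac_diam S).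
Qed.

Lemma coding_map_chain s N : SFT A s ->
  exists2 z, X z & coding_map X f ff s = f (s 0%N) (chain ff (s 0%N) (initial_word s N) z).
Proof.
move=> As; have : (\bigcap_k (word_map f ff s k @` X)) (coding_map X f ff s).
  by rewrite coding_map_spec.
by move=> /(_ N I)[z Xz zE]; exists z; rewrite // -zE word_mapE.
Qed.

End Coding.

(** * Infinite concatenations *)

Section Blocks.
Context {T : Type}.
Implicit Types (C : nat -> seq T).

Definition blocks C (M : nat) : seq T := flatten [seq C N | N <- iota 0 M].

(** When no [C N] is empty, the first [m.+1] of them suffice to determine the entry of
    index [m] of the infinite concatenation. *)
Definition concatenation x0 C (m : nat) : T := nth x0 (blocks C m.+1) m.

Lemma blocksS C M : blocks C M.+1 = blocks C M ++ C M.
Proof. by rewrite /blocks -addn1 iotaD map_cat flatten_cat /= add0n cats0. Qed.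

Lemma blocksD C M N : blocks C (M + N) = blocks C M ++ blocks (fun j => C (M + j)%N) N.
Proof.
elim: N => [|N IH]; first by rewrite addn0 cats0.
by rewrite addnS !blocksS IH catA.
Qed.

Lemma eq_blocks C C' M : (forall N, (N < M)%N -> C N = C' N) -> blocks C M = blocks C' M.
Proof.
move=> CC'; rewrite /blocks; congr flatten; apply/eq_in_map => N.
by rewrite mem_iota => /CC'.
Qed.

Lemma size_blocks C M : size (blocks C M) = (\sum_(0 <= N < M) size (C N))%N.
Proof.
elim: M => [|M IH]; first by rewrite big_geq.
by rewrite blocksS size_cat IH big_nat_recr.
Qed.

Lemma leq_size_blocks C M : (forall N, 0 < size (C N))%N -> (M <= size (blocks C M))%N.
Proof.
move=> C0; elim: M => // M IH; rewrite blocksS size_cat.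
by rewrite -addn1 leq_add.
Qed.

Lemma concatenationE x0 C M m : (forall N, 0 < size (C N))%N ->
  (m < size (blocks C M))%N -> concatenation x0 C m = nth x0 (blocks C M) m.
Proof.
move=> C0 mM; rewrite /concatenation.
have mm : (m < size (blocks C m.+1))%N by exact: leq_size_blocks.
have [/subnKC <-|/ltnW /subnKC E] := leqP m.+1 M.
  by rewrite blocksD nth_cat mm.
by rewrite -E blocksD nth_cat mM.
Qed.

End Blocks.

(** * Hausdorff measures and their covers *)

Section Hausdorff.
Context {R : realType} {n : nat}.
Local Notation V := 'rV[R]_n.
Implicit Types (E F U : set V) (s t delta : R).
Local Open Scope ereal_scope.

Lemma hausdorff_gauge_ge0 s U : 0 <= hausdorff_gauge s U.
Proof. by rewrite /hausdorff_gauge; case: ifPn => // _; exact: poweR_ge0. Qed.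

Lemma hausdorff_premeasure_ge0 delta s E : 0 <= hausdorff_premeasure delta s E.
Proof.
apply: le_ereal_inf_tmp => _ [U _ <-]; apply: nneseries_ge0 => k _ _.
exact: hausdorff_gauge_ge0.
Qed.

Lemma hausdorff_premeasure_le_measure delta s E : (0 < delta)%R ->
  hausdorff_premeasure delta s E <= hausdorff_measure s E.
Proof. by move=> d0; apply: ereal_sup_ubound; exists delta. Qed.

Lemma hausdorff_measure_ge0 s E : 0 <= hausdorff_measure s E.
Proof.
apply: le_trans (hausdorff_premeasure_ge0 1 s E) _.
exact: hausdorff_premeasure_le_measure ltr01.
Qed.

Lemma le_hausdorff_premeasure delta s E F : E `<=` F ->
  hausdorff_premeasure delta s E <= hausdorff_premeasure delta s F.
Proof.
move=> EF; apply: le_ereal_inf => _ [U [FU dU] <-].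
by exists U => //; split => //; exact: subset_trans FU.
Qed.

Lemma hausdorff_measure0_subset s E F : E `<=` F ->
  hausdorff_measure s F = 0 -> hausdorff_measure s E = 0.
Proof.
move=> EF F0; apply/eqP; rewrite eq_le hausdorff_measure_ge0 andbT -F0.
apply: ge_ereal_sup => _ [d /= d0 <-].
exact: le_trans (le_hausdorff_premeasure d s EF) (hausdorff_premeasure_le_measure _ _ d0).
Qed.

Lemma le_hausdorff_dim E F : E `<=` F -> hausdorff_dim E <= hausdorff_dim F.
Proof.
move=> EF; apply: le_ereal_inf => _ [s [s0 F0] <-].
by exists s => //; split => //; exact: hausdorff_measure0_subset F0.
Qed.

Lemma hausdorff_dim_le s E : (0 <= s)%R ->
  hausdorff_measure s E = 0 -> hausdorff_dim E <= s%:E.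
Proof. by move=> s0 E0; apply: ereal_inf_lbound; exists s. Qed.

Lemma ediam_le U (r : R) : (forall x y, U x -> U y -> (enorm (x - y) <= r)%R) ->
  ediam U <= r%:E.
Proof.
by move=> Ur; apply: ge_ereal_sup => _ [[x y] [/= Ux Uy] <-]; rewrite lee_fin Ur.
Qed.

Lemma ediam_ge U x y : U x -> U y -> (enorm (x - y))%:E <= ediam U.
Proof. by move=> Ux Uy; apply: ereal_sup_ubound; exists (x, y). Qed.

Lemma ediam_ge0 U : U !=set0 -> 0 <= ediam U.
Proof.
by move=> [x Ux]; apply: le_trans (ediam_ge Ux Ux); rewrite lee_fin enorm_ge0.
Qed.

Lemma hausdorff_gauge_set0 s : hausdorff_gauge s (set0 : set V) = 0.
Proof. by rewrite /hausdorff_gauge eqxx. Qed.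

Lemma hausdorff_gauge_le s U (r : R) : (0 <= s)%R -> (0 <= r)%R ->
  (forall x y, U x -> U y -> (enorm (x - y) <= r)%R) ->
  hausdorff_gauge s U <= (r `^ s)%:E.
Proof.
move=> s0 r0 Ur; rewrite /hausdorff_gauge; case: ifPn => [_|/set0P U0].
  by rewrite lee_fin powR_ge0.
rewrite -poweR_EFin gt0_ler_poweR ?ediam_le//.
- by rewrite in_itv/= ediam_ge0// leey.
- by rewrite in_itv/= lee_fin r0 leey.
Qed.

Lemma hausdorff_gauge_exponent s t U : (0 <= s)%R -> (s <= t)%R -> ediam U <= 1 ->
  hausdorff_gauge t U <= hausdorff_gauge s U.
Proof.
move=> s0 st U1; rewrite /hausdorff_gauge; case: ifPn => // /set0P U0.
have := ediam_ge0 U0; case: (ediam U) U1 => [r| |]//.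
rewrite !lee_fin => r1 r0.
have [->|rn0] := eqVneq r 0%R; last by rewrite ger_powR// r1 lt0r rn0 r0.
have [tE|tn0] := eqVneq t 0%R; last by rewrite (powR0 tn0) powR_ge0.
have -> : s = 0%R by lra.
by rewrite tE.
Qed.

Lemma hausdorff_measure0_exponent s t E : (0 <= s)%R -> (s <= t)%R ->
  hausdorff_measure s E = 0 -> hausdorff_measure t E = 0.
Proof.
move=> s0 st E0; apply/eqP; rewrite eq_le hausdorff_measure_ge0 andbT.
apply: ge_ereal_sup => _ [d /= d0 <-].
have d10 : (0 < Num.min d 1)%R by rewrite lt_min d0 ltr01.
rewrite -E0; apply: le_trans (hausdorff_premeasure_le_measure s E d10).
apply: le_ereal_inf_tmp => _ [U [EU dU] <-].
apply: le_trans; first apply: ereal_inf_lbound.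
  exists U => //; split => // k; apply: le_trans (dU k) _.
  by rewrite lee_fin ge_min lexx.
apply: lee_nneseries => k *; first exact: hausdorff_gauge_ge0.
apply: hausdorff_gauge_exponent => //; apply: le_trans (dU k) _.
by rewrite lee_fin ge_min lexx orbT.
Qed.

(** A cover given by one finite list for each natural number is enumerated by
    concatenating the lists, made nonempty by adding the empty set. *)
Lemma hausdorff_premeasure_le_cover delta s E (C : nat -> seq (set V)) (b : R) :
  (0 < delta)%R ->
  (forall x, E x -> exists N, exists2 U, U \in C N & U x) ->
  (forall N U, U \in C N -> ediam U <= delta%:E) ->
  (forall K, \sum_(0 <= N < K) \sum_(U <- C N) hausdorff_gauge s U <= b%:E) ->
  hausdorff_premeasure delta s E <= b%:E.
Proof.
move=> d0 EC Cd Cb.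
pose C' N := set0 :: C N.
have C'0 N : (0 < size (C' N))%N by [].
pose U := concatenation set0 C'.
have UE M m : (m < size (blocks C' M))%N -> U m = nth set0 (blocks C' M) m.
  exact: concatenationE.
apply: le_trans; first apply: ereal_inf_lbound.
  exists U => //; split.
    move=> x /EC[N [W WC Wx]].
    have Wb : W \in blocks C' N.+1.
      by rewrite blocksS mem_cat /C' inE WC !orbT.
    by exists (index W (blocks C' N.+1)); rewrite // (UE N.+1) ?index_mem// nth_index.
  move=> k; have ks : (k < size (blocks C' k.+1))%N by exact: leq_size_blocks.
  rewrite (UE k.+1)//; move: (mem_nth set0 ks).
  case/flattenP => _ /mapP[N _ ->]; rewrite inE => /predU1P[->|/Cd//].
  by apply: ediam_le => x y [].

apply: lime_le; first by apply: is_cvg_nneseries => k *; exact: hausdorff_gauge_ge0.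
apply: nearW => K; apply: le_trans (Cb K).
have Ks : (K <= size (blocks C' K))%N by exact: leq_size_blocks.
apply: (@le_trans _ _ (\sum_(W <- blocks C' K) hausdorff_gauge s W)).
  rewrite (big_nth set0) [leRHS](big_cat_nat (leq0n K) Ks)/=.
  rewrite [X in X <= _](_ : _ =
      \sum_(0 <= i < K) hausdorff_gauge s (nth set0 (blocks C' K) i)).
    by rewrite leeDl// sume_ge0// => i _; exact: hausdorff_gauge_ge0.
  apply: eq_big_nat => i /andP[_ iK]; rewrite (UE K)//; exact: leq_trans Ks.
rewrite /blocks big_flatten big_map /index_iota subn0 le_eqVlt; apply/orP; left.
apply/eqP; apply: eq_bigr => N _; by rewrite /C' big_cons/= hausdorff_gauge_set0 add0e.
Qed.

End Hausdorff.

(** * The mass distribution principle *)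

Section MassDistribution.
Context {R : realType} {I : choiceType}.
Context (W : nat -> seq I) (p : nat -> I -> R).
Context (W_uniq : forall j, uniq (W j)) (p_ge0 : forall j w, 0 <= p j w).
Context (p_sum1 : forall j, \sum_(w <- W j) p j w = 1).
Implicit Types (om : nat -> I).

Definition cylinder_mass om (T : nat) : R := \prod_(0 <= j < T) p j (om j).

Lemma cylinder_mass_ge0 om T : 0 <= cylinder_mass om T.
Proof. by apply: prodr_ge0 => j _. Qed.

Section Avoidance.
Context (u : nat -> nat -> I) (T : nat -> nat).
Let d := u 0 0.

(** The share of the [k]-th cylinder in the cylinder of words that start with [v]. *)
Let conditional_mass k (v : seq I) : R :=
  if all (fun j => nth d v j == u k j) (iota 0 (minn (size v) (T k)))
  then \prod_(size v <= j < T k) p j (u k j) else 0.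

Let conditional_mass_ge0 k v : 0 <= conditional_mass k v.
Proof. by rewrite /conditional_mass; case: ifP => // _; exact: prodr_ge0. Qed.

Let conditional_mass_rcons k v :
  \sum_(w <- W (size v)) p (size v) w * conditional_mass k (rcons v w) <=
  conditional_mass k v.
Proof.
have nthE w j : (j < size v)%N -> nth d (rcons v w) j = nth d v j.
  by move=> jv; rewrite nth_rcons jv.
have [Tv|vT] := leqP (T k) (size v).
  have E w : conditional_mass k (rcons v w) = conditional_mass k v.
    rewrite /conditional_mass size_rcons (minn_idPr Tv) (minn_idPr (leqW Tv)).
    rewrite (big_geq Tv) (big_geq (leqW Tv)); congr (if _ then _ else _).
    apply: eq_in_all => j; rewrite mem_iota => /andP[_ jT].
    by rewrite nthE//; exact: leq_trans Tv.
  under eq_bigr do rewrite E.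
  by rewrite -mulr_suml p_sum1 mul1r.
have E w : conditional_mass k (rcons v w) =
    if w == u k (size v) then
      if all (fun j => nth d v j == u k j) (iota 0 (size v))
      then \prod_((size v).+1 <= j < T k) p j (u k j) else 0
    else 0.
  rewrite /conditional_mass size_rcons (minn_idPl vT).
  rewrite -(addn1 (size v)) iotaD all_cat /= add0n nth_rcons ltnn eqxx andbT.
  rewrite (@eq_in_all _ _ (fun j => nth d v j == u k j)) ?addn1.
    by case: (w == _); rewrite ?andbT ?andbF.
  by move=> j; rewrite mem_iota => /andP[_ jT]; rewrite nthE.
under eq_bigr do rewrite E (fun_if (fun y => p (size v) _ * y)) mulr0.
rewrite -big_mkcond/= /conditional_mass (minn_idPl (ltnW vT)).
case: ifP => _; last by rewrite big1// => w _; rewrite mulr0.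
rewrite [leRHS]big_ltn//.
have [uW|uW] := boolP (u k (size v) \in W (size v)); last first.
  rewrite big1_seq ?mulr_ge0 ?prodr_ge0// => w /andP[/eqP-> wW].
  by rewrite wW in uW.
rewrite -big_filter filter_pred1_uniq//.
by rewrite big_seq1.
Qed.

Let total v : \bar R := (\sum_(0 <= k <oo) (conditional_mass k v)%:E)%E.

Let total_rcons v : (total v < 1)%E ->
  exists2 w, w \in W (size v) & (total (rcons v w) < 1)%E.
Proof.
apply: contraPP => /forall2NP H; apply/negP; rewrite -leNgt.
have H1 w : w \in W (size v) -> (1 <= total (rcons v w))%E.
  by move=> wW; case: (H w) => [//|/negP]; rewrite -leNgt.
apply: (@le_trans _ _ (\sum_(w <- W (size v)) (p (size v) w)%:E * total (rcons v w))%E).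
  rewrite -[1%E]/(1%:E) -(p_sum1 (size v)) -sumEFin big_seq [leRHS]big_seq.
  apply: lee_sum => w wW.
  by rewrite -[leLHS]mule1 lee_wpmul2l ?H1// lee_fin.
have E w : ((p (size v) w)%:E * total (rcons v w) =
    \sum_(0 <= k <oo) (p (size v) w * conditional_mass k (rcons v w))%:E)%E.
  rewrite /total -nneseriesZl; last by move=> *; rewrite lee_fin.
  by apply: eq_eseriesr => k _; rewrite EFinM.
under eq_bigr do rewrite E.
rewrite -nneseries_sum; last by move=> *; rewrite lee_fin mulr_ge0.
apply: lee_nneseries => [k _ _|k _]; rewrite sumEFin lee_fin//.
by rewrite sumr_ge0// => w _; rewrite mulr_ge0.
Qed.

(** If the shares of the given cylinders in the cylinder of a word add up to less than
    1, so do their shares in the cylinder of one of its one-letter extensions, because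
    the former sum is the average of the latter ones.  The sequence built in this way
    is in none of the cylinders, as a cylinder has share 1 in itself. *)
Lemma cylinder_avoidance :
  (\sum_(0 <= k <oo) (cylinder_mass (u k) (T k))%:E < 1)%E ->
  exists2 om, forall j, om j \in W j & forall k, exists2 j, (j < T k)%N & om j != u k j.
Proof.
move=> mass1.
have total0 : (total [::] < 1)%E.
  apply: le_lt_trans mass1; apply: lee_nneseries => k *; rewrite ?lee_fin//.
  by rewrite /conditional_mass /= min0n.
pose next v := xget d [set w | w \in W (size v) /\ (total (rcons v w) < 1)%E].
pose V j := iter j (fun v => rcons v (next v)) [::].
have size_V j : size (V j) = j by elim: j => //= j IH; rewrite size_rcons IH.
have next_spec v : (total v < 1)%E ->
    next v \in W (size v) /\ (total (rcons v (next v)) < 1)%E.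
  move=> /total_rcons[w wW wt].
  have Pw : exists w, [set w | w \in W (size v) /\ (total (rcons v w) < 1)%E] w.
    by exists w.
  exact: (xgetPex d Pw).
have V1 j : (total (V j) < 1)%E by elim: j => // j IH; have [] := next_spec _ IH.
have VE N j : (j < N)%N -> nth d (V N) j = next (V j).
  elim: N => // N IH; rewrite ltnS leq_eqVlt /= nth_rcons size_V.
  by case/predU1P => [->|jN]; [rewrite ltnn eqxx|rewrite jN IH].
exists (fun j => next (V j)).
  by move=> j; have [] := next_spec _ (V1 j); rewrite size_V.
move=> k; apply: contrapT => /forall2NP H.
have : (total (V (T k)) < 1)%E by [].
apply/negP; rewrite -leNgt.
have -> : 1%E = (conditional_mass k (V (T k)))%:E.
  rewrite /conditional_mass size_V minnn big_geq// ifT//.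
  apply/allP => j; rewrite mem_iota add0n => /andP[_ jT].
  by rewrite VE//; case: (H j) => // /negP; rewrite negbK.
apply: (@le_trans _ _ (\sum_(0 <= i < k.+1) (conditional_mass i (V (T k)))%:E)%E).
  by rewrite big_nat_recr//= leeDr// sume_ge0// => i _; rewrite lee_fin.
by apply: nneseries_lim_ge => i _ _; rewrite lee_fin.
Qed.

End Avoidance.

(** The mass distribution principle for a Cantor set coded by the sequences that pick
    one element from each finite set [W j].  A set of diameter at most [d] that contains
    the point coded by [u] contains only points coded in the cylinder of [u] of length
    [T], where [T] is the first time at which the mass is at most [C * d `^ t].  A cover
    with a small sum of the [d `^ t] thus gives cylinders of total mass less than 1 that
    contain all the sequences. *)
Lemma mass_distribution {n : nat} (Pi : (nat -> I) -> 'rV[R]_n) (t C : R) :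
  0 < t -> 0 < C ->
  (forall om, (forall j, om j \in W j) -> forall r : R, 0 < r ->
     exists T, cylinder_mass om T < r) ->
  (forall om om', (forall j, om j \in W j) -> (forall j, om' j \in W j) ->
     forall T, (forall j, (j < T)%N -> om j = om' j) -> om T != om' T ->
     cylinder_mass om T <= C * enorm (Pi om - Pi om') `^ t) ->
  hausdorff_measure t (Pi @` [set om | forall j, om j \in W j]) <> 0%E.
Proof.
move=> t0 C0 decay sep; set E := Pi @` _ => E0.
have /eqP P0 : hausdorff_premeasure 1 t E == 0%E.
  by rewrite eq_le hausdorff_premeasure_ge0 andbT -E0 hausdorff_premeasure_le_measure.
pose e := (4 * C)^-1.
have e0 : 0 < e by rewrite invr_gt0 mulr_gt0.
have [_ [U [EU U1] <-] Ue] : exists2 x, [set (\sum_(0 <= k <oo) hausdorff_gauge t (U k))%E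
    | U in [set U : nat -> set 'rV[R]_n | E `<=` \bigcup_k U k /\
                            forall k, (ediam (U k) <= 1%:E)%E]] x & (x < e%:E)%E.
  by apply: ereal_inf_lt; rewrite -/(hausdorff_premeasure 1 t E) P0 lte_fin.
(* A positive upper bound for the t-th power of the diameter of U k, also when that
   diameter is 0. *)
pose b k := fine (hausdorff_gauge t (U k)) + e / (2 ^ k.+1)%:R.
have gfin k : hausdorff_gauge t (U k) \is a fin_num.
  rewrite ge0_fin_numE ?hausdorff_gauge_ge0//.
  apply: le_lt_trans (ltry (1 `^ t)); apply: hausdorff_gauge_le => //; first exact: ltW.
  by move=> x y Ux Uy; rewrite -lee_fin; apply: le_trans (ediam_ge Ux Uy) (U1 k).
have b0 k : 0 < b k.
  rewrite ltr_wpDl ?divr_gt0 ?ltr0n ?expn_gt0//.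
  by apply: fine_ge0; exact: hausdorff_gauge_ge0.
have bdiam k x y : U k x -> U k y -> enorm (x - y) `^ t <= b k.
  move=> Ux Uy; rewrite -lee_fin /b EFinD fineK//.
  apply: (@le_trans _ _ (hausdorff_gauge t (U k))); last first.
    by rewrite leeDl// lee_fin divr_ge0// ltW.
  have U0 : U k !=set0 by exists x.
  rewrite /hausdorff_gauge ifF; last by apply/negP => /eqP Uk0; rewrite Uk0 in Ux.
  rewrite -poweR_EFin gt0_ler_poweR ?ediam_ge// ?(ltW t0)//.
    by rewrite in_itv/= lee_fin enorm_ge0 leey.
  by rewrite in_itv/= ediam_ge0// leey.
have bsum : (\sum_(0 <= k <oo) (b k)%:E <= (2 * e)%:E)%E.
  apply: (@le_trans _ _ (\sum_(0 <= k <oo) hausdorff_gauge t (U k) + e%:E)%E).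
    rewrite (_ : (\sum_(0 <= k <oo) (b k)%:E)%E = (\sum_(0 <= k <oo)
      (hausdorff_gauge t (U k) + (e / (2 ^ k.+1)%:R)%:E))%E); last first.
      by apply: eq_eseriesr => k _; rewrite /b EFinD fineK.
    by apply: epsilon_trick; [move=> k; exact: hausdorff_gauge_ge0|exact: ltW].
  by rewrite mulrDl mul1r EFinD leeD2r// ltW.
have [om0 om0W] : exists om, forall j, om j \in W j.
  have Wj j : exists w, w \in W j.
    have := p_sum1 j; case: (W j) => [|w r]; last by exists w; rewrite inE eqxx.
    by move/eqP; rewrite big_nil eq_sym oner_eq0.
  by have [om omW] := choice Wj; exists om.
have pick_u k : exists v : nat -> I, (forall j, v j \in W j) /\
    ((exists2 om, (forall j, om j \in W j) & U k (Pi om)) -> U k (Pi v)).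
  have [[om omW Uom]|H] := pselect (exists2 om, (forall j, om j \in W j) & U k (Pi om)).
    by exists om.
  by exists om0.
have [u uP] := choice pick_u.
have TP k : exists T, cylinder_mass (u k) T <= C * b k.
  have [T /ltW TP] := decay _ (uP k).1 _ (mulr_gt0 C0 (b0 k)).
  by exists T.
pose T k := ex_minn (TP k).
have [|om omW omu] := @cylinder_avoidance u T.
  apply: (@le_lt_trans _ _ (\sum_(0 <= k <oo) C%:E * (b k)%:E)%E).
    apply: lee_nneseries => k *; first by rewrite lee_fin cylinder_mass_ge0.
    by rewrite -EFinM lee_fin /T; case: ex_minnP.
  rewrite nneseriesZl; last by move=> *; rewrite lee_fin ltW.
  apply: (@le_lt_trans _ _ (C%:E * (2 * e)%:E)%E).
    by rewrite lee_wpmul2l// lee_fin ltW.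
  rewrite -EFinM lte_fin /e invfM mulrCA mulrA.
  have -> : 2 * C * (4^-1 * C^-1) = 2 / 4 * (C / C) by ring.
  by rewrite divff ?gt_eqF// mulr1; lra.
have /EU[k _ Uk] : E (Pi om) by exists om.
have [uW uU] := uP k.
have {}uU : U k (Pi (u k)) by apply: uU; exists om.
have /ex_minnP[j omj jmin] : exists j, om j != u k j.
  by have [j _ omj] := omu k; exists j.
have jT : (j < T k)%N by have [i iT omi] := omu k; apply: leq_trans iT; rewrite ltnS jmin.
have : (T k <= j)%N; last by rewrite leqNgt jT.
rewrite /T; case: ex_minnP => m _; apply.
apply: le_trans (_ : C * enorm (Pi (u k) - Pi om) `^ t <= _); last first.
  by rewrite ler_wpM2l ?(ltW C0)// bdiam.
apply: sep => //; last by rewrite eq_sym.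
move=> i ij; apply/esym/eqP; rewrite -[_ == _]negbK; apply/negP => /jmin.
by rewrite leqNgt ij.
Qed.

End MassDistribution.

(** * Large disjoint families of words in a level set *)

(** Choose a largest element, discard what meets it, and repeat. *)
Lemma finite_vitali {R : realType} {T : eqType} (D : T -> R) (meet : rel T) (s : seq T) :
  reflexive meet -> symmetric meet ->
  exists Z, [/\ uniq Z, {subset Z <= s},
    {in Z &, forall w w', w != w' -> ~~ meet w w'} &
    forall w, w \in s -> exists2 z, z \in Z & meet z w && (D w <= D z)].
Proof.
move=> mrefl msym.
have maxD (r : seq T) : r != [::] -> exists2 h, h \in r & forall w, w \in r -> D w <= D h.
  elim: r => // x [|y r] IH _.
    by exists x; rewrite ?inE// => w; rewrite inE => /eqP->.
  have [h hr hmax] := IH isT.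
  have [xh|hx] := leP (D x) (D h).
    exists h; first by rewrite inE hr orbT.
    by move=> w; rewrite inE => /predU1P[->|/hmax].
  exists x; first by rewrite inE eqxx.
  by move=> w; rewrite inE => /predU1P[->//|/hmax /le_trans]; apply; exact: ltW.
have [m] := ubnP (size s); elim: m s => // m IH s sm.
have [->|s0] := eqVneq s [::]; first by exists [::].
have [h hs hmax] := maxD s s0.
have [|Z [Zu Zs Zd Zc]] := IH [seq w <- s | ~~ meet h w].
  rewrite size_filter -ltnS; apply: leq_trans _ sm; rewrite ltnS.
  rewrite -(count_predC (meet h) s) addnC -[X in (X < _)%N]addn0 ltn_add2l.
  by rewrite -has_count; apply/hasP; exists h => //; exact: mrefl.
have hZ z : z \in Z -> ~~ meet h z by move=> /Zs; rewrite mem_filter => /andP[].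
exists (h :: Z); split.
- by rewrite /= Zu andbT; apply/negP => /hZ; rewrite mrefl.
- by move=> w; rewrite inE => /predU1P[->//|/Zs]; rewrite mem_filter => /andP[].
- move=> w w'; rewrite !inE => /predU1P[->|wZ] /predU1P[->|w'Z].
  + by rewrite eqxx.
  + by move=> _; exact: hZ.
  + by move=> _; rewrite msym; exact: hZ.
  + exact: Zd.
- move=> w ws; have [hw|hw] := boolP (meet h w).
    by exists h; rewrite ?inE ?eqxx// hw hmax.
  have [|z zZ zw] := Zc w; first by rewrite mem_filter hw.
  by exists z; rewrite // inE zZ orbT.
Qed.

Lemma geometric_tail {R : realType} (r : R) M K : 0 <= r < 1 ->
  \sum_(0 <= N < K) (if (N < M)%N then 0 else r ^+ N) <= r ^+ M / (1 - r).
Proof.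
move=> /andP[r0 r1]; have r1' : 0 < 1 - r by rewrite subr_gt0.
suff -> : \sum_(0 <= N < K) (if (N < M)%N then 0 else r ^+ N) =
    (r ^+ M - r ^+ maxn K M) / (1 - r).
  by rewrite ler_wpM2r ?invr_ge0 ?(ltW r1')// lerBlDr lerDl exprn_ge0.
elim: K => [|K IH]; first by rewrite big_geq// max0n subrr mul0r.
rewrite big_nat_recr//= IH; have [KM|MK] := ltnP K M.
  by rewrite addr0 (maxn_idPr KM).
rewrite (maxn_idPl (leqW MK)) exprS.
apply/eqP; rewrite eq_sym -subr_eq0; apply/eqP; field; by rewrite gt_eqF.
Qed.

Lemma lt_ereal_real {R : realType} (s : R) (x : \bar R) : (s%:E < x)%E ->
  exists2 t : R, s < t & (t%:E < x)%E.
Proof.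
case: x => [r| |]//; last by exists (s + 1); rewrite ?ltrDl ?ltry.
rewrite lte_fin => sr; exists ((s + r) / 2); rewrite ?lte_fin; lra.
Qed.

Definition level_set {R : realType} {n q : nat} (A : 'M[bool]_q) (X : set 'rV[R]_n)
    (f : 'I_q -> 'rV[R]_n -> 'rV[R]_n) (ff : 'I_q -> 'I_q -> 'rV[R]_n -> 'rV[R]_n)
    (g : symbolic_space q -> R) (x0 : R) : set 'rV[R]_n :=
  [set y | limit_set A X f ff y /\ accumulation_set A X f ff g y x0].

Section Families.
Context {R : realType} {n q : nat}.
Local Notation V := 'rV[R]_n.
Context {A : 'M[bool]_q}.
Context {X : set V} {f : 'I_q -> V -> V} {ff : 'I_q -> 'I_q -> V -> V} {c k D : R}.
Context (X_compact : compact X) (X_nonempty : X !=set0).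
Context (S : asymptotically_conformal X (edge A) ff c k D).
Context (f_contraction : forall i x y, X x -> X y ->
  enorm (f i x - f i y) <= enorm (x - y)).
Context (g : symbolic_space q -> R) (x0 : R).
Local Notation F := (chain ff).
Local Notation diam a w := (image_diam X (F a w)).
Local Notation level := (level_set A X f ff g x0).

Lemma level_set_times y (e : R) M : level y -> 0 < e -> exists s, exists N,
  [/\ SFT A s, coding_map X f ff s = y, (M <= N)%N &
      `|birkhoff g s N - N%:R * x0| <= N%:R * e].
Proof.
move=> [_ [s [As sy scl]]] e0.
have [|z [[N /= MN <-] xN]] := scl [set ergodic_average g s N | N in [set N | (M.+1 <= N)%N]]
    (ball x0 e) _ (nbhsx_ballx _ _ e0).
  by exists M.+1 => // N MN; exists N.
exists s, N; split => //; first exact: ltnW.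
have N0 : 0 < (N%:R : R) by rewrite ltr0n (leq_trans _ MN).
have -> : birkhoff g s N = N%:R * ergodic_average g s N.
  by rewrite /ergodic_average mulrA mulfV ?gt_eqF// mul1r.
rewrite -mulrBr normrM gtr0_norm// ler_wpM2l ?(ltW N0)// distrC.
exact/ltW.
Qed.

Definition good_word (e : R) (N : nat) (ab : 'I_q * 'I_q) (w : seq 'I_q) : Prop :=
  exists s, [/\ SFT A s, s 0%N = ab.1, s N = ab.2, w = initial_word s N &
    `|birkhoff g s N - N%:R * x0| <= N%:R * e].

Lemma good_word_path e N ab w : good_word e N ab w ->
  [/\ path (edge A) ab.1 w, last ab.1 w = ab.2 & size w = N].
Proof.
move=> [s [As <- <- -> _]].
by rewrite last_initial_word size_initial_word; split => //; exact: initial_word_path.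
Qed.

Lemma good_words_finite e N ab : exists W : seq (seq 'I_q),
  uniq W /\ forall w, w \in W <-> good_word e N ab w.
Proof.
exists [seq w <- [seq tval t | t <- enum {: N.-tuple 'I_q}] | `[< good_word e N ab w >]].
split.
  by rewrite filter_uniq// map_inj_uniq ?enum_uniq//; exact: val_inj.
move=> w; rewrite mem_filter; split=> [/andP[/asboolP//]|gw].
have [_ _ wN] := good_word_path gw.
apply/andP; split; first exact/asboolP.
by apply/mapP; exists (tcast wN (in_tuple w)); rewrite ?mem_enum// val_tcast.
Qed.

Definition disjoint_words (a : 'I_q) (Z : seq (seq 'I_q)) : Prop :=
  {in Z &, forall w w', w != w' -> F a w @` X `&` F a w' @` X = set0}.

Lemma good_words_vitali e N ab : exists Z : seq (seq 'I_q),
  [/\ uniq Z, forall w, w \in Z -> good_word e N ab w, disjoint_words ab.1 Z &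
    forall w, good_word e N ab w -> exists2 z, z \in Z &
      F ab.1 z @` X `&` F ab.1 w @` X !=set0 /\ diam ab.1 w <= diam ab.1 z].
Proof.
have [W [Wu WP]] := good_words_finite e N ab.
pose meet w w' := `[< F ab.1 w @` X `&` F ab.1 w' @` X !=set0 >].
have [||Z [Zu ZW Zd Zc]] := @finite_vitali R _ (fun w => diam ab.1 w) meet W.
- move=> w; apply/asboolP; have [x Xx] := X_nonempty.
  by exists (F ab.1 w x); split; exists x.
- by move=> w w'; rewrite /meet setIC.
exists Z; split => //.
- by move=> w /ZW /WP.
- move=> w w' wZ w'Z ww'; have := Zd _ _ wZ w'Z ww'.
  by move=> /asboolP; rewrite -subset0 => H y Hy; apply: H; exists y.
- move=> w /WP /Zc[z zZ /andP[/asboolP zw Dwz]].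
  by exists z.
Qed.

Let neighbourhood (a : 'I_q) (w : seq 'I_q) : set V :=
  [set y | exists2 x, X x & enorm (y - f a (F a w x)) <= diam a w].

Let neighbourhood_diam a w y y' : path (edge A) a w ->
  neighbourhood a w y -> neighbourhood a w y' -> enorm (y - y') <= 3 * diam a w.
Proof.
move=> aw [x Xx yx] [x' Xx' yx'].
have xx' := f_contraction a (chain_maps S aw Xx) (chain_maps S aw Xx').
have Fxx' := image_diam_ub S aw Xx Xx'.
have := enorm_dist y (f a (F a w x)) y'.
have := enorm_dist (f a (F a w x)) (f a (F a w x')) y'.
rewrite (enormB (f a (F a w x')) y'); lra.
Qed.

Let neighbourhood_meet a w z x : path (edge A) a w -> path (edge A) a z ->
  F a z @` X `&` F a w @` X !=set0 -> diam a w <= diam a z -> X x ->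
  neighbourhood a z (f a (F a w x)).
Proof.
move=> aw az [y [[x1 Xx1 x1y] [x2 Xx2 x2y]]] Dwz Xx.
exists x1 => //; rewrite x1y -x2y; apply: le_trans Dwz.
apply: le_trans (f_contraction _ (chain_maps S aw Xx) (chain_maps S aw Xx2)) _.
exact: (image_diam_ub S aw).
Qed.

(** Otherwise the neighbourhoods of the images in the families given by
    [good_words_vitali], for all pairs of end symbols and all large [N], cover the level
    set.  For [s2 > s] and each [N] the sum of the [s2]-th powers of their diameters is
    at most a constant times [c `^ (s2 - s) ^+ N], so the sum over [N] tends to 0 as the
    lower bound for [N] increases, and the level set has [s2]-dimensional measure 0. *)
Lemma large_disjoint_family (s e : R) M : 0 <= s -> (s%:E < hausdorff_dim level)%E ->
  0 < e -> exists N ab Z,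
  [/\ (M <= N)%N, uniq Z, forall w, w \in Z -> good_word e N ab w,
      disjoint_words ab.1 Z & 1 <= \sum_(w <- Z) diam ab.1 w `^ s].
Proof.
move=> s0 /lt_ereal_real[s2 ss2 s2dim] e0; apply: contrapT => H.
have s20 : 0 < s2 by exact: le_lt_trans ss2.
have /andP[c0 c1] := ac_contraction_range S; have D0 := ac_diam_gt0 S.
suff H0 : hausdorff_measure s2 level = 0%E.
  by have := hausdorff_dim_le (ltW s20) H0; rewrite leNgt s2dim.
have [Z ZP] := choice (fun Nab : nat * ('I_q * 'I_q) => good_words_vitali e Nab.1 Nab.2).
have Zsum N ab : (M <= N)%N -> \sum_(w <- Z (N, ab)) diam ab.1 w `^ s < 1.
  move=> MN; rewrite ltNge; apply/negP => Z1; apply: H.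
  by exists N, ab, (Z (N, ab)); have [] := ZP (N, ab).
pose r := c `^ (s2 - s).
have r0 : 0 < r by exact: powR_gt0.
have r1 : r < 1.
  rewrite -(powRr0 c) /r /powR gt_eqF// ltr_expR.
  by rewrite ltr_nM2r ?ln_lt0 ?c0// subr_gt0.
pose B := (#|{: 'I_q * 'I_q}|)%:R * (3 `^ s2 * D `^ (s2 - s)).
have B0 : 0 <= B by rewrite !mulr_ge0// powR_ge0.
have Dle N ab w : w \in Z (N, ab) -> 0 <= diam ab.1 w <= c ^+ N * D.
  have [_ + _ _] := ZP (N, ab); move=> /(_ w) /[apply] /good_word_path [/= aw _ wN].
  by rewrite (image_diam_ge0 S)//= -{1}wN (image_diam_expr S).
apply/eqP; rewrite eq_le hausdorff_measure_ge0 andbT.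
apply: ge_ereal_sup => _ [d /= d0 <-].
apply/lee_addgt0Pr => b b0; rewrite add0e.
have [M1 M1P] : exists M1, forall N, (M1 <= N)%N -> c ^+ N * D * 3 <= d.
  have d3 : 0 < d / 3 by rewrite divr_gt0.
  have [M1 M1P] := geometric_small (ac_contraction_range S) (ltW D0) d3.
  by exists M1 => N /M1P; rewrite ltr_pdivlMr// => /ltW.
have [M2 M2P] : exists M2, forall N, (M2 <= N)%N -> r ^+ N * B <= b * (1 - r).
  have d3 : 0 < b * (1 - r) by rewrite mulr_gt0// subr_gt0.
  have r01 : 0 < r < 1 by rewrite r0.
  have [M2 M2P] := geometric_small r01 B0 d3.
  by exists M2 => N /M2P /ltW.
pose L := maxn M (maxn M1 M2).
pose C N := if (N < L)%N then [::] else
  flatten [seq [seq neighbourhood ab.1 w | w <- Z (N, ab)] | ab <- enum {: 'I_q * 'I_q}].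
have inC N U : U \in C N -> exists ab w, [/\ (L <= N)%N, w \in Z (N, ab) &
    U = neighbourhood ab.1 w].
  rewrite /C; case: ltnP => // LN /flattenP[_ /mapP[ab _ ->] /mapP[w wZ ->]].
  by exists ab, w.
have ndiam N ab w y y' : w \in Z (N, ab) -> neighbourhood ab.1 w y ->
    neighbourhood ab.1 w y' -> enorm (y - y') <= 3 * diam ab.1 w.
  have [_ + _ _] := ZP (N, ab); move=> /(_ w) /[apply] /good_word_path [/= aw _ _].
  exact: neighbourhood_diam.
apply: (@hausdorff_premeasure_le_cover _ _ _ _ _ C) => //.
- move=> y Ey; have [t [N [At ty LN tN]]] := level_set_times L Ey e0.
  pose ab := (t 0%N, t N).
  have gw : good_word e N ab (initial_word t N) by exists t.
  have [_ Zg _ /(_ _ gw)[z zZ [zt Dtz]]] := ZP (N, ab).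
  exists N, (neighbourhood ab.1 z).
    rewrite /C ltnNge LN /=; apply/flattenP.
    exists [seq neighbourhood ab.1 w | w <- Z (N, ab)].
      by apply/mapP; exists ab; rewrite ?mem_enum.
    by apply/mapP; exists z.
  have [x Xx tE] := coding_map_chain X_compact X_nonempty S f_contraction N At.
  rewrite -ty tE; apply: neighbourhood_meet => //; first exact: initial_word_path.
  by have [] := good_word_path (Zg _ zZ).
- move=> N U /inC[ab [w [LN wZ ->]]]; apply: ediam_le => y y' Hy Hy'.
  apply: le_trans (ndiam _ _ _ _ _ wZ Hy Hy') _; rewrite mulrC.
  have /andP[_ Dw] := Dle _ _ _ wZ.
  apply: le_trans (M1P N _); last by rewrite (leq_trans _ LN)// /L !leq_max leqnn orbT.
  by rewrite ler_wpM2r.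
- move=> K.
  have level N : (\sum_(U <- C N) hausdorff_gauge s2 U <=
      (if (N < L)%N then 0 else r ^+ N * B)%:E)%E.
    rewrite /C; case: ltnP => LN; first by rewrite big_nil.
    rewrite big_flatten big_map.
    have MN : (M <= N)%N by rewrite (leq_trans _ LN)// leq_max leqnn.
    apply: (@le_trans _ _ (\sum_(ab <- enum {: 'I_q * 'I_q})
        (3 `^ s2 * (c ^+ N * D) `^ (s2 - s))%:E)%E).
      apply: lee_sum => ab _; rewrite big_map.
      apply: (@le_trans _ _ (\sum_(w <- Z (N, ab))
          (3 `^ s2 * (c ^+ N * D) `^ (s2 - s) * diam ab.1 w `^ s)%:E)%E).
        rewrite big_seq [leRHS]big_seq; apply: lee_sum => w wZ.
        have /andP[Dw0 Dw] := Dle _ _ _ wZ.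
        have Dw3 : 0 <= 3 * diam ab.1 w by rewrite mulr_ge0.
        have nw y y' := @ndiam N ab w y y' wZ.
        apply: le_trans (hausdorff_gauge_le (ltW s20) Dw3 nw) _.
        rewrite lee_fin powRM// -mulrA ler_wpM2l ?powR_ge0//.
        have -> : diam ab.1 w `^ s2 = diam ab.1 w `^ (s2 - s) * diam ab.1 w `^ s.
          by rewrite -powRD ?subrK// gt_eqF.
        rewrite ler_wpM2r ?powR_ge0// ge0_ler_powR ?nnegrE ?subr_ge0 ?(ltW ss2)//.
        by rewrite mulr_ge0 ?exprn_ge0 ?ltW.
      rewrite sumEFin lee_fin -mulr_sumr ler_piMr ?(ltW (Zsum _ _ MN))//.
      by rewrite mulr_ge0 ?powR_ge0.
    rewrite sumEFin lee_fin big_const_seq count_predT -cardE iter_addr_0.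
    rewrite powRM ?exprn_ge0 ?(ltW c0) ?(ltW D0)// -powR_mulrn ?(ltW c0)// powRAC.
    rewrite powR_mulrn ?powR_ge0// -[leLHS]mulr_natl /B le_eqVlt.
    by apply/orP; left; apply/eqP; rewrite -/r; ring.
  apply: le_trans (lee_sum _ (fun N _ => level N)) _.
  rewrite sumEFin lee_fin.
  apply: (@le_trans _ _ ((\sum_(0 <= N < K) (if (N < L)%N then 0 else r ^+ N)) * B)).
    rewrite mulr_suml; apply: ler_sum => N _.
    by case: ifP => _; rewrite ?mul0r.
  have r01 : 0 <= r < 1 by rewrite (ltW r0).
  apply: le_trans (ler_wpM2r B0 (geometric_tail L K r01)) _.
  rewrite mulrAC ler_pdivrMr ?subr_gt0//.
  by apply: M2P; rewrite /L !leq_max leqnn !orbT.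
Qed.

End Families.

(** * Families of loops *)

Lemma finite_uniform_radius {R : realType} {T : eqType} (l : seq T) (P : T -> R -> Prop) :
  (forall i, i \in l -> exists2 r : R, 0 < r & forall t, 0 < t <= r -> P i t) ->
  exists2 r : R, 0 < r & forall i t, i \in l -> 0 < t <= r -> P i t.
Proof.
elim: l => [|i l IH] H; first by exists 1.
have [j jl|r r0 rP] := IH; first by apply: H; rewrite inE jl orbT.
have [|r' r'0 r'P] := H i; first by rewrite inE eqxx.
exists (Num.min r r'); first by rewrite lt_min r0.
move=> j t; rewrite inE le_min => /predU1P[->|jl] /andP[t0 /andP[tr tr']].
  by apply: r'P; rewrite t0.
by apply: rP; rewrite // t0.
Qed.

Lemma archimedean_multiple {R : realType} (x h : R) : 0 < h ->
  exists M, forall N, (M <= N)%N -> x <= N%:R * h.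
Proof.
move=> h0; exists (Num.bound `|x / h|) => N MN.
rewrite -ler_pdivrMr//; apply: le_trans (ler_norm _) _.
by apply: le_trans (ltW (archi_boundP (normr_ge0 _))) _; rewrite ler_nat.
Qed.

(** Starting and ending at the same symbol makes the words freely concatenable.  The
    inequality [lf_sum] is the one that forces a self-similar set with separated pieces
    of ratios [m w] to have dimension at least [s]. *)
Record loop_family {R : realType} {n q : nat} (A : 'M[bool]_q) (X : set 'rV[R]_n)
    (ff : 'I_q -> 'I_q -> 'rV[R]_n -> 'rV[R]_n) (c : R) (a : 'I_q)
    (g : symbolic_space q -> R) (x0 s e : R)
    (Z : seq (seq 'I_q)) (l : nat) (m : seq 'I_q -> R) (sep : R) : Prop := {
  lf_uniq : uniq Z;
  lf_size_gt0 : (0 < l)%N;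
  lf_size : forall w, w \in Z -> size w = l;
  lf_path : forall w, w \in Z -> path (edge A) a w;
  lf_last : forall w, w \in Z -> last a w = a;
  lf_range : forall w, w \in Z -> 0 < m w <= c;
  lf_lower : forall w x y, w \in Z -> X x -> X y ->
    m w * enorm (x - y) <= enorm (chain ff a w x - chain ff a w y);
  lf_sum : 1 <= \sum_(w <- Z) m w `^ s;
  lf_sep_gt0 : 0 < sep;
  lf_sep : forall w w' x y, w \in Z -> w' \in Z -> w != w' -> X x -> X y ->
    sep <= enorm (chain ff a w x - chain ff a w' y);
  lf_average : forall t, SFT A t -> t 0%N = a -> initial_word t l \in Z ->
    `|birkhoff g t l - l%:R * x0| <= l%:R * e
}.

Section Loops.
Context {R : realType} {n q : nat}.
Local Notation V := 'rV[R]_n.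
Context {A : 'M[bool]_q}.
Context {X : set V} {f : 'I_q -> V -> V} {ff : 'I_q -> 'I_q -> V -> V} {c k D : R}.
Context (X_compact : compact X) (X_nonempty : X !=set0).
Context (S : asymptotically_conformal X (edge A) ff c k D).
Context (f_contraction : forall i x y, X x -> X y ->
  enorm (f i x - f i y) <= enorm (x - y)).
Context (A_transitive : transitive_SFT A).
Context (g : symbolic_space q -> R) (gcont : {within SFT A, continuous g}) (x0 : R).
Local Notation F := (chain ff).
Local Notation diam a w := (image_diam X (F a w)).

Lemma disjoint_images_apart a w a' w' : path (edge A) a w -> path (edge A) a' w' ->
  F a w @` X `&` F a' w' @` X = set0 ->
  exists2 r : R, 0 < r & forall x y, X x -> X y -> r <= enorm (F a w x - F a' w' y).
Proof.
move=> aw aw' disj.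
have [|r r0 rP] := @compact_uniform_radius2 R n X (fun r x y => X x -> X y ->
    r <= enorm (F a w x - F a' w' y)) X_compact.
  move=> x y Xx Xy; pose h := enorm (F a w x - F a' w' y).
  have h0 : 0 < h.
    rewrite lt0r enorm_ge0 andbT enorm_eq0 subr_eq0; apply/eqP => xy.
    suff : set0 (F a w x) by [].
    by rewrite -disj; split; [exists x|exists y].
  exists (h / 3) => [|x' y' t x'x y'y /andP[t0 th] Xx' Xy']; first by rewrite divr_gt0.
  have := chain_contraction1 S aw Xx' Xx; have := chain_contraction1 S aw' Xy' Xy.
  have := enorm_dist (F a w x) (F a w x') (F a' w' y).
  have := enorm_dist (F a w x') (F a' w' y') (F a' w' y).
  rewrite (enormB (F a w x) (F a w x')) -/h; lra.
by exists r => // x y Xx Xy; exact: rP.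
Qed.

Lemma agree_initial_word (s t : symbolic_space q) N :
  s 0%N = t 0%N -> initial_word s N = initial_word t N ->
  agree N.+1 s t.
Proof.
move=> st0 st j jN.
by rewrite -(@nth_initial_word q s N (s 0%N)) ?st0 ?st ?nth_initial_word.
Qed.

Lemma occurring_iter (s : symbolic_space q) N : SFT A s -> occurring A (s N).
Proof.
by move=> As; exists (iter N shift s); [exact: SFT_iter_shift|rewrite iter_shiftE addn0].
Qed.

(** The words of a large disjoint family are completed to loops by connecting words
    that are the same for the whole family.  By bounded distortion the images have
    nearly the inverse Lipschitz bound as diameter, and the loss of dimension from
    [s1] to [s] pays for the distortion and for the connecting words. *)
Lemma loop_family_exists (a : 'I_q) (s e : R) : occurring A a ->
  0 < s -> (s%:E < hausdorff_dim (level_set A X f ff g x0))%E ->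
  0 < e -> exists Z l m sep, loop_family A X ff c a g x0 s e Z l m sep.
Proof.
move=> oa s0 /lt_ereal_real[s1 ss1 s1dim] e0.
have /andP[c0 c1] := ac_contraction_range S; have D0 := ac_diam_gt0 S.
have /andP[k0 k1] := ac_lower_range S.
pose rho := c `^ ((s1 - s) / 2).
have rho0 : 0 < rho by exact: powR_gt0.
have half0 : 0 < (s1 - s) / 2 by rewrite divr_gt0// subr_gt0.
have powc_lt1 z : 0 < z -> c `^ z < 1.
  move=> z0; rewrite -(powRr0 c) /powR gt_eqF// ltr_expR.
  by rewrite ltr_nM2r ?ln_lt0 ?c0.
have rho1 : rho < 1 by exact: powc_lt1.
(* With this d, (1 + d) `^ - s is the square root of c `^ (s1 - s). *)
pose d := c `^ (- ((s1 - s) / 2 / s)) - 1.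
have d1E : 1 + d = c `^ (- ((s1 - s) / 2 / s)) by rewrite /d addrC subrK.
have d0 : 0 < d.
  rewrite subr_gt0 powRN -[ltLHS]invr1 ltf_pV2 ?posrE ?powR_gt0//.
  by apply: powc_lt1; rewrite divr_gt0.
have d1rho : ((1 + d) `^ s)^-1 = rho.
  by rewrite d1E -powRrM mulNr divfK ?gt_eqF// powRN invrK.
have [C C0 CP] := chain_lower_diam S X_nonempty d0.
have [G G0 GP] := observable_bounded gcont.
have e30 : 0 < e / 3 by rewrite divr_gt0.
have [B B0 BP] := birkhoff_agree gcont e30.
have conn (ab : 'I_q * 'I_q) : exists w, occurring A ab.1 -> occurring A ab.2 ->
    path (edge A) ab.1 w /\ last ab.1 w = ab.2.
  have [Hl|Hl] := pselect (occurring A ab.1); last by exists [::].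
  have [Hr|Hr] := pselect (occurring A ab.2); last by exists [::].
  by have [w wP] := occurring_connect A_transitive Hl Hr; exists w.
have [cw cwP] := choice conn.
pose L := (\max_ab size (cw ab))%N.
have cwL ab : (size (cw ab) <= L)%N by exact: (leq_bigmax ab).
pose K := k ^+ (L + L) * C.
have K0 : 0 < K by rewrite mulr_gt0// exprn_gt0.
have [M1 M1P] : exists M1, forall N, (M1 <= N)%N -> rho ^+ N * D `^ (s1 - s) < K `^ s.
  by apply: geometric_small; rewrite ?rho0 ?powR_ge0 ?powR_gt0.
pose E := (L + L)%:R * (G + `|x0|) + B.
have [M2 M2P] : exists M2, forall N, (M2 <= N)%N -> E <= N%:R * (e / 3).
  by apply: archimedean_multiple.
have [N [[a1 b1] [Z0 [MN Z0u Z0g Z0d Z0s]]]] := large_disjoint_family X_compact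
  X_nonempty S f_contraction (maxn 1 (maxn M1 M2)) (ltW (lt_trans s0 ss1)) s1dim e30.
have N0 : (0 < N)%N by rewrite (leq_trans _ MN)// leq_max.

rewrite /= in Z0d Z0s.
pose u1 := cw (a, a1); pose u2 := cw (b1, a).
have [w1 w1Z] : exists w, w \in Z0.
  case: (Z0) Z0s => [|w r]; last by exists w; rewrite inE eqxx.
  by rewrite big_nil ler10.
have [aocc bocc] : occurring A a1 /\ occurring A b1.
  have [t [At /= <- <- _ _]] := Z0g _ w1Z.
  by split; exact: occurring_iter.
have [u1p u1l] := cwP (a, a1) oa aocc; have [u2p u2l] := cwP (b1, a) bocc oa.
rewrite /= -/u1 -/u2 in u1p u1l u2p u2l.
have Z0p w : w \in Z0 -> [/\ path (edge A) a1 w, last a1 w = b1 & size w = N].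
  by move=> /Z0g /good_word_path.
pose loop w := u1 ++ w ++ u2.
have loop_path w : w \in Z0 -> path (edge A) a (loop w).
  by move=> /Z0p[wp wl _]; rewrite /loop !cat_path u1p u1l wp wl.
have loop_last w : w \in Z0 -> last a (loop w) = a.
  by move=> /Z0p[_ wl _]; rewrite /loop !last_cat u1l wl.
have loopE w x : w \in Z0 -> F a (loop w) x = F a u1 (F a1 w (F b1 u2 x)).
  by move=> /Z0p[_ wl _]; rewrite /loop (@chain_cat R n _ ff) u1l (@chain_cat R n _ ff) wl.
have u2X x : X x -> X (F b1 u2 x) by exact: (chain_maps S).
have wX w x : w \in Z0 -> X x -> X (F a1 w x).
  by move=> /Z0p[wp _ _]; exact: (chain_maps S).
(* Two points of X are needed for the diameters to be positive. *)
have [p [p' [Xp Xp' pp']]] : exists p p', [/\ X p, X p' & 0 < enorm (p - p')].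
  apply: contrapT => H; move: Z0s; apply/negP; rewrite -ltNge.
  rewrite big_seq big1 ?ltr01// => w wZ.
  have [wp _ _] := Z0p _ wZ.
  suff -> : diam a1 w = 0 by rewrite powR0// gt_eqF// (lt_trans s0).
  apply/eqP; rewrite eq_le (image_diam_ge0 S)// andbT.
  apply: image_diam_le => // x y Xx Xy.
  apply: le_trans (chain_contraction1 S wp Xx Xy) _.
  by rewrite leNgt; apply/negP => xy; apply: H; exists x, y.
have diam0 w : w \in Z0 -> 0 < diam a1 w.
  move=> /Z0p[wp _ _]; apply: lt_le_trans (image_diam_ub S wp Xp Xp').
  by apply: lt_le_trans (chain_lower S wp Xp Xp'); rewrite mulr_gt0// exprn_gt0.
pose m v := K * (1 + d) ^- N * diam a1 (take N (drop (size u1) v)).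
have mE w : w \in Z0 -> m (loop w) = K * (1 + d) ^- N * diam a1 w.
  by move=> /Z0p[_ _ wN]; rewrite /m /loop drop_size_cat// take_size_cat.
have d1N : 0 < (1 + d) ^- N by rewrite invr_gt0 exprn_gt0// addr_gt0.
have m_lower w x y : w \in Z0 -> X x -> X y ->
    m (loop w) * enorm (x - y) <= enorm (F a (loop w) x - F a (loop w) y).
  move=> wZ Xx Xy; rewrite mE// !loopE//.
  have [wp _ wN] := Z0p _ wZ.
  apply: le_trans (chain_lower S u1p (wX _ _ wZ (u2X _ Xx)) (wX _ _ wZ (u2X _ Xy))).
  have := CP _ _ _ _ wp (u2X _ Xx) (u2X _ Xy); rewrite wN => CPw.
  apply: le_trans (ler_wpM2l (exprn_ge0 _ (ltW k0)) CPw).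
  have lowu2 := chain_lower S u2p Xx Xy.
  have Cd0 : 0 <= C * (1 + d) ^- N * diam a1 w.
    by rewrite !mulr_ge0 ?(ltW C0) ?(ltW d1N) ?ltW ?diam0.
  apply: le_trans (ler_wpM2l (exprn_ge0 _ (ltW k0)) (ler_wpM2l Cd0 lowu2)).
  rewrite /K; set e1 := enorm (x - y); set Cd := C * _ * _ in Cd0 *.
  have -> : k ^+ (L + L) * C * (1 + d) ^- N * diam a1 w * e1 = k ^+ (L + L) * (Cd * e1).
    by rewrite /Cd; ring.
  have -> : k ^+ size u1 * (Cd * (k ^+ size u2 * e1)) = k ^+ (size u1 + size u2) * (Cd * e1).
    by rewrite exprD; ring.
  apply: ler_wpM2r; first by apply: mulr_ge0 => //; exact: enorm_ge0.
  by rewrite ler_wiXn2l ?(ltW k0)// leq_add ?cwL.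
have Z0inj : injective loop.
  move=> w w' /eqP; rewrite /loop eqseq_cat// eqxx/= => /eqP ww'.
  have sww' : size w = size w'.
    by have := congr1 size ww'; rewrite !size_cat => /addIn.
  by move: ww' => /eqP; rewrite eqseq_cat// => /andP[/eqP].
have apart : exists2 r : R, 0 < r & forall (ww' : seq 'I_q * seq 'I_q) t,
    ww' \in [seq (w, w') | w <- Z0, w' <- Z0] -> 0 < t <= r ->
    ww'.1 != ww'.2 -> forall x y, X x -> X y ->
    t <= enorm (F a (loop ww'.1) x - F a (loop ww'.2) y).
  apply: finite_uniform_radius => -[w w'] /allpairsP[[v v'] [/= vZ v'Z [-> ->]]].
  have [->|vv'] := eqVneq v v'; first by exists 1; rewrite // ?ltr01// => t _ /negP.
  have [|r r0 rP] := disjoint_images_apart (loop_path _ vZ) (loop_path _ v'Z).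
    rewrite -subset0 => z [[x Xx xz] [y Xy yz]].
    have : F a (loop v) x = F a (loop v') y by rewrite xz yz.
    rewrite !loopE//.
    move/(chain_inj S u1p (wX _ _ vZ (u2X _ Xx)) (wX _ _ v'Z (u2X _ Xy))) => vv'E.
    suff : set0 (F a1 v (F b1 u2 x)) by [].
    rewrite -(Z0d v v' vZ v'Z vv'); split; first by exists (F b1 u2 x) => //; exact: u2X.
    by rewrite vv'E; exists (F b1 u2 y) => //; exact: u2X.
  exists r => // t /andP[_ tr] _ x y Xx Xy.
  exact: le_trans (rP _ _ Xx Xy).
have [sep sep0 sepP] := apart.
exists [seq loop w | w <- Z0], (size u1 + (N + size u2))%N, m, sep.
split.
- by rewrite map_inj_uniq.
- by rewrite addnCA ltn_addr.
- by move=> _ /mapP[w /Z0p[_ _ wN] ->]; rewrite /loop !size_cat wN.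
- by move=> _ /mapP[w wZ ->]; exact: loop_path.
- by move=> _ /mapP[w wZ ->]; exact: loop_last.
- move=> _ /mapP[w wZ ->]; apply/andP; split.
    by rewrite mE// mulr_gt0 ?diam0// mulr_gt0.
  rewrite -(ler_pM2r pp'); apply: le_trans (m_lower _ _ _ wZ Xp Xp') _.
  apply: le_trans (chain_contraction S (loop_path _ wZ) Xp Xp') _.
  rewrite ler_wpM2r ?enorm_ge0// -[leRHS]expr1 ler_wiXn2l ?(ltW c0) ?(ltW c1)//.
  by have [_ _ wN] := Z0p _ wZ; rewrite /loop !size_cat wN addnCA ltn_addr.
- by move=> _ x y /mapP[w wZ ->]; exact: m_lower.
- rewrite big_map.
  have cND0 : 0 < c ^+ N * D by rewrite mulr_gt0// exprn_gt0.
  have scale w : w \in Z0 -> diam a1 w `^ s1 <= m (loop w) `^ s.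
    move=> wZ; have [wp _ wN] := Z0p _ wZ.
    have dw := diam0 _ wZ.
    have dwc : diam a1 w <= c ^+ N * D by rewrite -wN (image_diam_expr S).
    rewrite mE// powRM ?(ltW dw)//; last by rewrite mulr_ge0// ltW.
    have -> : diam a1 w `^ s1 = diam a1 w `^ (s1 - s) * diam a1 w `^ s.
      by rewrite -powRD ?subrK// gt_eqF// (lt_trans s0).
    rewrite ler_wpM2r ?powR_ge0//.
    apply: (@le_trans _ _ ((c ^+ N * D) `^ (s1 - s))).
      by rewrite ge0_ler_powR ?nnegrE ?subr_ge0 ?(ltW ss1) ?(ltW dw) ?(ltW cND0).
    rewrite powRM ?exprn_ge0 ?(ltW c0) ?(ltW D0)//.
    rewrite (powRM s (ltW K0) (ltW d1N)).
    have -> : ((1 + d) ^- N) `^ s = rho ^+ N.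
      have d1 : 0 <= 1 + d by rewrite addr_ge0// ltW.
      rewrite -d1rho -powR_invn// -powRrM mulNr powRN mulrC powRrM.
      by rewrite powR_mulrn ?powR_ge0// exprVn.
    have -> : (c ^+ N) `^ (s1 - s) = rho ^+ N * rho ^+ N.
      rewrite -exprMn /rho -powRD; last by rewrite (gt_eqF c0) implybT.
      rewrite -splitr -powR_mulrn ?(ltW c0)// powRAC powR_mulrn ?powR_ge0//.
    rewrite -mulrA [leRHS]mulrC ler_wpM2l ?exprn_ge0 ?(ltW rho0)//.
    by apply/ltW/M1P; rewrite (leq_trans _ MN)// !leq_max leqnn orbT.
  apply: le_trans Z0s _; rewrite big_seq [leRHS]big_seq.
  by apply: ler_sum => w; exact: scale.
- by [].
- move=> _ _ x y /mapP[w wZ ->] /mapP[w' w'Z ->] ww' Xx Xy.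
  apply: (sepP (w, w')) => //=; first by apply/allpairsP; exists (w, w').
    by rewrite sep0 lexx.
  by apply: contra_neq ww' => ->.
- move=> t At ta /mapP[w wZ].
  have [_ _ wN] := Z0p _ wZ; have [r [Ar /= ra rb rw rx]] := Z0g _ wZ.
  rewrite /loop !initial_wordD => /eqP.
  rewrite eqseq_cat ?size_initial_word// => /andP[/eqP tu1].
  rewrite eqseq_cat ?size_initial_word// => /andP[/eqP tw /eqP tu2].
  set t1 := iter (size u1) shift t in tw tu2 *.
  have At1 : SFT A t1 by exact: SFT_iter_shift.
  have t1a : t1 0%N = a1.
    by rewrite /t1 iter_shiftE addn0 -last_initial_word tu1 ta.
  have rt1 : agree N r t1.
    have := @agree_initial_word r t1 N; rewrite ra t1a tw -rw => /(_ erefl erefl) h j jN.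
    by apply: h; exact: ltnW.
  have rt1B := BP _ _ _ Ar At1 rt1.
  rewrite !birkhoffD -/t1.
  have S1 := birkhoff_bounded (size u1) GP At.
  have S2 := birkhoff_bounded (size u2) GP (SFT_iter_shift N At1).
  have EN : E <= N%:R * (e / 3).
    by apply: M2P; rewrite (leq_trans _ MN)// !leq_max leqnn !orbT.
  have uL : (size u1)%:R + (size u2)%:R <= ((L + L)%:R : R).
    by rewrite -natrD ler_nat leq_add ?cwL.
  have Gx0 : 0 <= G + `|x0| by rewrite addr_ge0// ltW.
  have uE := ler_wpM2r Gx0 uL.
  have u1x : `|(size u1)%:R * x0| <= (size u1)%:R * `|x0| by rewrite normrM ger0_norm.
  have u2x : `|(size u2)%:R * x0| <= (size u2)%:R * `|x0| by rewrite normrM ger0_norm.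
  have u1e : 0 <= (size u1)%:R * e by rewrite mulr_ge0// ltW.
  have u2e : 0 <= (size u2)%:R * e by rewrite mulr_ge0// ltW.
  move: rt1B rx S1 S2 EN uE u1x u2x u1e u2e; rewrite /E !natrD.
  set b1' := birkhoff g t _; set b2 := birkhoff g t1 _; set b3 := birkhoff g (iter N _ _) _.
  set br := birkhoff g r N; set n1 := (size u1)%:R; set n2 := (size u2)%:R.
  set y1 := n1 * x0; set y2 := n2 * x0; set nN := N%:R.
  rewrite !ler_norml !mulrDl !mulrDr -/y1 -/y2; set yN := nN * x0.
  move=> /andP[r1 r2] /andP[r3 r4] /andP[r5 r6] /andP[r7 r8] EN uE.
  move=> /andP[r9 r10] /andP[r11 r12] u1e u2e.
  by apply/andP; split; lra.
Qed.

End Loops.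

(** * Infinite sequences of loops *)

(** The duration of stage [k] is chosen once the total length of the blocks used before
    it is known, and large enough to postpone stage [k.+1] beyond [thr k.+1]. *)
Lemma schedule (l thr : nat -> nat) : exists stage tau : nat -> nat,
  [/\ forall T, stage T = 0%N \/ (thr (stage T) <= T)%N,
      forall k T, (tau k <= T < tau k.+1)%N -> stage T = k,
      forall k, (k <= tau k)%N &
      forall k, (tau k + k.+1 * (\sum_(0 <= T < tau k) l (stage T)) <= tau k.+1)%N].
Proof.
pose st := fix st k := if k is k'.+1 then
  let d := (thr k + k * (st k').2).+1 in
  ((st k').1 + d, (st k').2 + d * l k')%N else (0%N, 0%N).
pose tau k := (st k).1.
pose d k := (thr k.+1 + k.+1 * (st k).2).+1.
have tauS k : tau k.+1 = (tau k + d k)%N by [].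
have tau_mono j k : (j <= k)%N -> (tau j <= tau k)%N.
  move=> /subnKC <-; elim: (k - j)%N => [|i IH]; rewrite ?addn0//.
  by rewrite addnS tauS (leq_trans IH)// leq_addr.
have tau_ge k : (k <= tau k)%N.
  by elim: k => // k IH; rewrite tauS -addn1 leq_add.
have ex_stage T : exists k, (T < tau k.+1)%N by exists T; exact: tau_ge.
pose stage T := ex_minn (ex_stage T).
have stageE k T : (tau k <= T < tau k.+1)%N -> stage T = k.
  move=> /andP[kT Tk]; rewrite /stage; case: ex_minnP => m Tm mmin.
  apply/eqP; rewrite eqn_leq mmin//= leqNgt; apply/negP => mk.
  by have := leq_trans Tm (leq_trans (tau_mono _ _ mk) kT); rewrite ltnn.
have lenE k : (\sum_(0 <= T < tau k) l (stage T))%N = (st k).2.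
  elim: k => [|k IH]; first by rewrite big_geq.
  rewrite (big_cat_nat (leq0n _) (tau_mono _ _ (leqnSn k)))/= IH; congr addn.
  rewrite (@eq_big_nat _ _ _ _ _ _ (fun=> l k)); last by move=> T /stageE ->.
  by rewrite sum_nat_const_nat tauS addKn.
exists stage, tau; split => //.
- move=> T; have [k Tk kmin] : exists2 k, (T < tau k.+1)%N & stage T = k.
    by exists (stage T) => //; rewrite /stage; case: ex_minnP.
  case: k => [|k] in Tk kmin *; [by left|right; rewrite kmin].
  have kT : (tau k.+1 <= T)%N.
    rewrite leqNgt; apply/negP => Tk'; move: kmin; rewrite /stage.
    by case: ex_minnP => m _ /(_ _ Tk') mk mE; rewrite mE ltnn in mk.
  by apply: leq_trans kT; rewrite tauS (leq_trans _ (leq_addl _ _))// leqW// leq_addr.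
- by move=> k; rewrite lenE tauS leq_add2l leqW// leq_addl.
Qed.

Lemma every_index_infinitely_often : exists idx : nat -> nat,
  forall i M, exists2 k, (M <= k)%N & idx k = i.
Proof.
exists (fun k => logn 2 k.+1) => i M.
have pos : (0 < 2 ^ i * (2 * M).+1)%N by rewrite muln_gt0 expn_gt0.
exists (2 ^ i * (2 * M).+1).-1.
  have : (1 <= 2 ^ i)%N by rewrite expn_gt0.
  nia.
rewrite prednK// lognM ?expn_gt0// pfactorK// logn_coprime ?addn0//.
by rewrite coprime2n /= mul2n odd_double.
Qed.

Section LoopSequences.
Context {R : realType} {n q : nat}.
Local Notation V := 'rV[R]_n.
Context {A : 'M[bool]_q}.
Context {X : set V} {ff : 'I_q -> 'I_q -> V -> V} {c k D : R}.
Context (S : asymptotically_conformal X (edge A) ff c k D).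
Context (a : 'I_q) (om : nat -> seq 'I_q).
Context (om_size : forall T, (0 < size (om T))%N).
Context (om_path : forall T, path (edge A) a (om T)).
Context (om_last : forall T, last a (om T) = a).
Local Notation F := (chain ff).

Definition loop_sequence : symbolic_space q :=
  fun j => if j is j'.+1 then concatenation a om j' else a.

Lemma initial_word_loop_sequence T :
  initial_word loop_sequence (size (blocks om T)) = blocks om T.
Proof.
apply: (@eq_from_nth _ a); first by rewrite size_initial_word.
move=> j; rewrite size_initial_word => jT.
by rewrite nth_mkseq//= (concatenationE a om_size jT).
Qed.

Lemma blocks_last T : last a (blocks om T) = a.
Proof. by elim: T => // T IH; rewrite blocksS last_cat IH om_last. Qed.

Lemma blocks_path T : path (edge A) a (blocks om T).
Proof. by elim: T => // T IH; rewrite blocksS cat_path IH blocks_last om_path. Qed.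

Lemma loop_sequence_SFT : SFT A loop_sequence.
Proof.
move=> j; have jT : (j < size (blocks om j.+1))%N by exact: leq_size_blocks.
have /(pathP a)/(_ _ jT) := blocks_path j.+1.
have -> : nth a (a :: blocks om j.+1) j = loop_sequence j.
  case: j jT => //= j jT; rewrite (concatenationE a om_size (ltnW jT)).
  by [].
rewrite -(concatenationE a om_size jT) => /asboolP[s As [i [si si1]]].
by have := As i; rewrite si si1.
Qed.

Lemma loop_sequence_size T : loop_sequence (size (blocks om T)) = a.
Proof. by rewrite -last_initial_word initial_word_loop_sequence blocks_last. Qed.

Lemma initial_word_shift T :
  initial_word (iter (size (blocks om T)) shift loop_sequence) (size (om T)) = om T.
Proof.
have := initial_word_loop_sequence T.+1.
rewrite blocksS size_cat initial_wordD initial_word_loop_sequence => /eqP.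
by rewrite eqseq_cat// eqxx => /eqP.
Qed.

Lemma blocks_lower (mu : nat -> R) T :
  (forall j, 0 <= mu j) ->
  (forall j x y, X x -> X y ->
     mu j * enorm (x - y) <= enorm (F a (om j) x - F a (om j) y)) ->
  forall x y, X x -> X y -> (\prod_(0 <= j < T) mu j) * enorm (x - y) <=
    enorm (F a (blocks om T) x - F a (blocks om T) y).
Proof.
move=> mu0 mulow; elim: T => [|T IH] x y Xx Xy; first by rewrite big_geq// mul1r.
rewrite blocksS !(@chain_cat R n _ ff) blocks_last big_nat_recr//=.
apply: le_trans (IH _ _ (chain_maps S (om_path T) Xx) (chain_maps S (om_path T) Xy)).
by rewrite -mulrA ler_wpM2l ?mulow// prodr_ge0.
Qed.

Lemma birkhoff_blocks (h : symbolic_space q -> R) (y e : R) T j :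
  (forall i, (T <= i < T + j)%N -> forall t, SFT A t -> t 0%N = a ->
    initial_word t (size (om i)) = om i ->
    `|birkhoff h t (size (om i)) - (size (om i))%:R * y| <= (size (om i))%:R * e) ->
  `|birkhoff h loop_sequence (size (blocks om (T + j)))
    - birkhoff h loop_sequence (size (blocks om T))
    - ((size (blocks om (T + j)))%:R - (size (blocks om T))%:R) * y| <=
  ((size (blocks om (T + j)))%:R - (size (blocks om T))%:R) * e.
Proof.
elim: j => [|j IH] H; first by rewrite addn0 !subrr !mul0r subr0 normr0.
have szE : (size (blocks om (T + j).+1) = size (blocks om (T + j)) + size (om (T + j)%N))%N.
  by rewrite blocksS size_cat.
have : `|birkhoff h loop_sequence (size (blocks om (T + j)))
    - birkhoff h loop_sequence (size (blocks om T))
    - ((size (blocks om (T + j)))%:R - (size (blocks om T))%:R) * y| <=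
  ((size (blocks om (T + j)))%:R - (size (blocks om T))%:R) * e.
  apply: IH => i /andP[Ti iT]; apply: H.
  by rewrite Ti (leq_trans iT)// addnS.
have := H (T + j)%N _ _ (SFT_iter_shift (size (blocks om (T + j))) loop_sequence_SFT) _
  (initial_word_shift (T + j)).
rewrite leq_addr addnS ltnS leqnn iter_shiftE addn0 loop_sequence_size => /(_ isT erefl).
rewrite szE birkhoffD natrD.
set b1 := birkhoff h _ _; set b2 := birkhoff h _ _; set b3 := birkhoff h _ _.
set n1 := (size (om _))%:R; set n2 := (size _)%:R; set n3 := (size _)%:R.
rewrite !ler_norml => /andP[r1 r2] /andP[r3 r4].
by apply/andP; split; lra.
Qed.

End LoopSequences.

(** * The Cantor set in the intersection of the level sets *)

Section CantorSet.
Context {R : realType} {n q : nat}.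
Local Notation V := 'rV[R]_n.
Context {A : 'M[bool]_q}.
Context {X : set V} {f : 'I_q -> V -> V} {ff : 'I_q -> 'I_q -> V -> V} {c k D : R}.
Context (X_compact : compact X) (X_nonempty : X !=set0).
Context (S : asymptotically_conformal X (edge A) ff c k D).
Context (f_contraction : forall i x y, X x -> X y ->
  enorm (f i x - f i y) <= enorm (x - y)).
Context (f_lower : forall i x y, X x -> X y ->
  k * enorm (x - y) <= enorm (f i x - f i y)).
Context (A_transitive : transitive_SFT A).
Context (g : nat -> symbolic_space q -> R).
Context (gcont : forall i, {within SFT A, continuous (g i)}).
Context (x0 : nat -> R).
Local Notation F := (chain ff).
Local Notation level i := (level_set A X f ff (g i) (x0 i)).

(** The sequences [om] of loops taken, during stage [j], from a family adapted to the
    observable number [idx j] with precision [1 / (j + 1)].  At the end of such a stage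
    the ergodic average is close to [x0 (idx j)].  The constant [C1] accounts for the
    first stage, which starts at time 0, before the gap [r 0] can be neglected. *)
Lemma cantor_subset (a : 'I_q) (s t : R) : occurring A a -> 0 < t -> t < s ->
  (forall i, (s%:E < hausdorff_dim (level i))%E) ->
  hausdorff_measure t (\bigcap_i level i) <> 0%E.
Proof.
move=> oa t0 ts sdim; have s0 : 0 < s by exact: lt_trans ts.
have /andP[c0 c1] := ac_contraction_range S.
have /andP[k0 k1] := ac_lower_range S.
have [idx idxP] := every_index_infinitely_often.
have fam j : exists Zlmr : seq (seq 'I_q) * nat * (seq 'I_q -> R) * R,
    loop_family A X ff c a (g (idx j)) (x0 (idx j)) s (j.+1%:R^-1)
      Zlmr.1.1.1 Zlmr.1.1.2 Zlmr.1.2 Zlmr.2.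
  have j0 : 0 < (j.+1%:R^-1 : R) by rewrite invr_gt0.
  have [Z [l [m [r H]]]] := loop_family_exists X_compact X_nonempty S f_contraction
    A_transitive (@gcont (idx j)) oa s0 (sdim (idx j)) j0.
  by exists (Z, l, m, r).
have [fm fmP] := choice fam.
pose Z j := (fm j).1.1.1; pose l j := (fm j).1.1.2.
pose m j := (fm j).1.2; pose r j := (fm j).2.
have {}fmP j : loop_family A X ff c a (g (idx j)) (x0 (idx j)) s (j.+1%:R^-1)
  (Z j) (l j) (m j) (r j) by exact: fmP.
pose rho := c `^ (s - t).
have rho0 : 0 < rho by exact: powR_gt0.
have rho1 : rho < 1.
  by rewrite -(powRr0 c) /rho /powR gt_eqF// ltr_expR ltr_nM2r ?ln_lt0 ?c0// subr_gt0.
have rt0 j : 0 < r j `^ t by rewrite powR_gt0// (lf_sep_gt0 (fmP j)).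
have thrP j : exists M, forall T, (M <= T)%N -> rho ^+ T <= r j `^ t.
  have rho01 : 0 < rho < 1 by rewrite rho0.
  have [M MP] := geometric_small rho01 ler01 (rt0 j).
  by exists M => T /MP; rewrite mulr1 => /ltW.
have [thr {}thrP] := choice thrP.
have [stage [tau [stage_thr stageE tau_ge tau_len]]] := schedule l thr.
pose C1 := 1 + (r 0%N `^ t)^-1.
have C11 : 1 <= C1 by rewrite lerDl invr_ge0 powR_ge0.
have C10 : 0 < C1 by exact: lt_le_trans C11.
have rhor T : rho ^+ T <= C1 * r (stage T) `^ t.
  case: (stage_thr T) => [->|/thrP h].
    apply: (@le_trans _ _ 1); first by rewrite exprn_ile1// ltW.
    by rewrite mulrDl mulVf ?gt_eqF// mul1r lerDr ltW.
  by apply: le_trans h _; rewrite ler_peMl// ltW.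
pose W T := Z (stage T).
pose sumW T := \sum_(w <- W T) m (stage T) w `^ s.
pose p T w := m (stage T) w `^ s / sumW T.
have sumW1 T : 1 <= sumW T by exact: (lf_sum (fmP (stage T))).
have sumW0 T : 0 < sumW T by exact: lt_le_trans (sumW1 T).
have Wu T : uniq (W T) by exact: (lf_uniq (fmP (stage T))).
have p0 T w : 0 <= p T w by rewrite divr_ge0 ?powR_ge0// ltW.
have p1 T : \sum_(w <- W T) p T w = 1.
  rewrite /p -mulr_suml -/(sumW T) divff//; apply/eqP => sW0.
  by have := sumW0 T; rewrite sW0 ltxx.
pose Om := [set om : nat -> seq 'I_q | forall T, om T \in W T].
have Om_size om T : Om om -> size (om T) = l (stage T).
  by move=> /(_ T) /(lf_size (fmP (stage T))).
have Om_size0 om : Om om -> forall T, (0 < size (om T))%N.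
  by move=> Omo T; rewrite (Om_size _ _ Omo) (lf_size_gt0 (fmP (stage T))).
have Om_path om : Om om -> forall T, path (edge A) a (om T).
  by move=> Omo T; apply: (lf_path (fmP (stage T))); exact: Omo.
have Om_last om : Om om -> forall T, last a (om T) = a.
  by move=> Omo T; apply: (lf_last (fmP (stage T))); exact: Omo.
pose Pi om := coding_map X f ff (loop_sequence a om).
pose mprod (om : nat -> seq 'I_q) T := \prod_(0 <= j < T) m (stage j) (om j).
have m_range om T : Om om -> 0 < m (stage T) (om T) <= c.
  by move=> /(_ T) /(lf_range (fmP (stage T))).
have mprod_gt0 om T : Om om -> 0 < mprod om T.
  by move=> Omo; apply: prodr_gt0 => j _; have /andP[] := m_range _ j Omo.
have mprod_le om T : Om om -> mprod om T <= c ^+ T.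
  move=> Omo; rewrite /mprod -[T in leRHS]subn0 -prodr_const_nat.
  by apply: ler_prod => j _; have /andP[/ltW -> ->] := m_range _ j Omo.
have mass_le om T : Om om -> cylinder_mass p om T <= mprod om T `^ s.
  move=> Omo; rewrite /cylinder_mass /mprod.
  elim: T => [|T IH]; first by rewrite !big_geq// powR1.
  have /andP[mT _] := m_range _ T Omo.
  rewrite !big_nat_recr//= powRM ?(ltW mT)//; last exact/ltW/mprod_gt0.
  rewrite ler_pM//; first by apply: prodr_ge0 => j _.
  by rewrite ler_pdivrMr// ler_peMr// powR_ge0.
have code om T : Om om -> exists2 z, X z &
    Pi om = f a (F a (blocks om T) (F a (om T) z)).
  move=> Omo; have sA := loop_sequence_SFT (Om_size0 _ Omo) (Om_path _ Omo) (Om_last _ Omo).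
  have [z Xz zE] := coding_map_chain X_compact X_nonempty S f_contraction
    (size (blocks om T.+1)) sA.
  exists z => //; rewrite /Pi zE (initial_word_loop_sequence a (Om_size0 _ Omo)).
  by rewrite blocksS (@chain_cat R n _ ff) (blocks_last (Om_last _ Omo)).
have sepPi om om' T : Om om -> Om om' -> (forall j, (j < T)%N -> om j = om' j) ->
    om T != om' T -> k * (mprod om T * r (stage T)) <= enorm (Pi om - Pi om').
  move=> Omo Omo' eqT neT.
  have [z Xz ->] := code om T Omo; have [z' Xz' ->] := code om' T Omo'.
  rewrite -(eq_blocks eqT).
  have XF y o : Om o -> X y -> X (F a (o T) y).
    by move=> Oo; apply: (chain_maps S); exact: Om_path.
  have Xb y : X y -> X (F a (blocks om T) y).
    by apply: (chain_maps S); apply: blocks_path; [exact: Om_path|exact: Om_last].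
  apply: le_trans (f_lower _ (Xb _ (XF _ _ Omo Xz)) (Xb _ (XF _ _ Omo' Xz'))).
  rewrite ler_wpM2l ?(ltW k0)//.
  have low : forall y y', X y -> X y' -> mprod om T * enorm (y - y') <=
      enorm (F a (blocks om T) y - F a (blocks om T) y').
    apply: (blocks_lower S (Om_path _ Omo) (Om_last _ Omo)).
      by move=> j; have /andP[/ltW] := m_range _ j Omo.
    by move=> j y y' Xy Xy'; apply: (lf_lower (fmP (stage j))) => //; exact: Omo.
  apply: le_trans (low _ _ (XF _ _ Omo Xz) (XF _ _ Omo' Xz')).
  rewrite ler_wpM2l ?(ltW (mprod_gt0 _ _ Omo))//.
  exact: (lf_sep (fmP (stage T)) (Omo T) (Omo' T) neT).
have KE : Pi @` Om `<=` \bigcap_i level i.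
  move=> _ [om Omo <-] i _.
  have sA := loop_sequence_SFT (Om_size0 _ Omo) (Om_path _ Omo) (Om_last _ Omo).
  set u := loop_sequence a om in sA *.
  split; first by exists u.
  exists u; split => // U B [N0 _ N0U] /nbhs_ballP[e /= e0 eB].
  have [G G0 GP] := observable_bounded (@gcont i).
  pose E := G + `|x0 i| + 1.
  have [M MP] := archimedean_multiple (E + 1) e0.
  have [j Mj ji] := idxP i (maxn M N0).
  pose N := size (blocks om (tau j.+1)).
  pose N1 := size (blocks om (tau j)).
  have tau_j : (tau j <= tau j.+1)%N.
    exact: leq_trans (leq_addr _ _) (tau_len j).
  have tN : (tau j.+1 <= N)%N by apply: leq_size_blocks; exact: Om_size0.
  have N1N : (j.+1 * N1 <= N)%N.
    rewrite /N1 size_blocks (eq_bigr (fun T => l (stage T))) => [|T _]; last exact: Om_size.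
    by apply: leq_trans (leq_trans (leq_addl _ _) (tau_len j)) tN.
  have jN : (j < N)%N by apply: leq_trans tN.
  have avg : `|birkhoff (g i) u N - birkhoff (g i) u N1 - (N%:R - N1%:R) * x0 i| <=
      (N%:R - N1%:R) * j.+1%:R^-1.
    rewrite /N -(subnKC tau_j).
    apply: (birkhoff_blocks (Om_size0 _ Omo) (Om_path _ Omo) (Om_last _ Omo)).
    move=> T; rewrite subnKC// => /stageE Tj v Av va vT.
    have sT : size (om T) = l j by rewrite (Om_size _ _ Omo) Tj.
    rewrite sT -ji; apply: (lf_average (fmP j)) => //.
    by rewrite -sT vT -Tj; exact: Omo.
  have S1 := birkhoff_bounded N1 GP sA.
  exists (ergodic_average (g i) u N); split.
    by apply: N0U; rewrite /= (leq_trans _ (ltnW jN))// (leq_trans _ Mj)// leq_maxr.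
  apply: eB; rewrite -ball_normE /ball_ /=.
  have NR : 0 < (N%:R : R) by rewrite ltr0n (leq_trans _ jN).
  have SN : birkhoff (g i) u N = N%:R * ergodic_average (g i) u N.
    by rewrite /ergodic_average mulrA mulfV ?gt_eqF// mul1r.
  have jR : 0 < (j.+1%:R : R) by [].
  rewrite distrC -(ltr_pM2l NR) -{1}(ger0_norm (ltW NR)) -normrM mulrBr -SN.
  have N1R : N1%:R <= N%:R / j.+1%:R :> R.
    by rewrite ler_pdivlMr// mulrC -natrM ler_nat.
  have N1x : `|N1%:R * x0 i| <= N1%:R * `|x0 i| by rewrite normrM ger0_norm.
  have NE : N%:R / j.+1%:R * (E + 1) <= N%:R * e.
    rewrite -mulrA ler_wpM2l ?(ltW NR)// ler_pdivrMl//.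
    apply: le_trans (MP j.+1 _) _ => //.
    by rewrite (leq_trans _ (leqnSn _))// (leq_trans _ Mj)// leq_maxl.
  have Nj : 0 < N%:R / j.+1%:R :> R by rewrite divr_gt0.
  have G1 : 0 <= G + `|x0 i| by rewrite addr_ge0// ltW.
  have N1E := ler_wpM2r G1 N1R.
  have N1j : 0 <= N1%:R / j.+1%:R :> R by rewrite divr_ge0.
  move: avg S1 N1x NE N1E N1j Nj; rewrite /E !mulrDr !mulrBl !mulr1.
  set b1 := birkhoff _ _ _; set b2 := birkhoff _ _ _.
  set y1 := N1%:R * x0 i; set y2 := N%:R * x0 i; set z := N%:R / j.+1%:R.
  set z1 := N1%:R / _.
  rewrite !ler_norml ltr_norml => /andP[r1 r2] /andP[r3 r4] /andP[r5 r6] r7 r8 r9 r10.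
  by apply/andP; split; lra.
move=> H0; have {H0} : hausdorff_measure t (Pi @` Om) = 0%E.
  exact: hausdorff_measure0_subset KE H0.
pose C := C1 / k `^ t.
have C0 : 0 < C by rewrite divr_gt0// powR_gt0.
apply: (mass_distribution Wu p0 p1 t0 C0).
- move=> om Omo b b0.
  have cs : 0 < c `^ s < 1.
    rewrite powR_gt0//= -(powRr0 c) /powR gt_eqF// ltr_expR.
    by rewrite ltr_nM2r ?ln_lt0 ?c0.
  have [T TP] := geometric_small cs ler01 b0.
  exists T; apply: le_lt_trans (TP T (leqnn _)); rewrite mulr1.
  apply: le_trans (mass_le _ T Omo) _.
  rewrite -powR_mulrn ?powR_ge0// powRAC powR_mulrn ?(ltW c0)//.
  rewrite ge0_ler_powR ?nnegrE ?mprod_le ?exprn_ge0 ?(ltW s0) ?(ltW c0)//.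
  exact/ltW/mprod_gt0.
- move=> om om' Omo Omo' T eqT neT; apply: le_trans (mass_le _ T Omo) _.
  have M0 := mprod_gt0 om T Omo.
  have r0 := lf_sep_gt0 (fmP (stage T)).
  apply: (@le_trans _ _ (C * (k * (mprod om T * r (stage T))) `^ t)); last first.
    rewrite ler_wpM2l ?(ltW C0)// ge0_ler_powR ?nnegrE ?(ltW t0) ?enorm_ge0//.
      by rewrite !mulr_ge0 ?ltW.
    exact: sepPi.
  have kt0 : k `^ t != 0 by rewrite gt_eqF// powR_gt0.
  rewrite !powRM ?mulr_ge0 ?(ltW k0) ?(ltW M0) ?(ltW r0)//.
  have -> : C * (k `^ t * (mprod om T `^ t * r (stage T) `^ t)) =
      mprod om T `^ t * (C1 * r (stage T) `^ t) by rewrite /C; field.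
  have -> : mprod om T `^ s = mprod om T `^ t * mprod om T `^ (s - t).
    by rewrite -powRD addrC subrK// gt_eqF.
  rewrite ler_wpM2l ?powR_ge0//.
  apply: le_trans (rhor T); rewrite /rho.
  rewrite -powR_mulrn ?powR_ge0// powRAC powR_mulrn ?(ltW c0)//.
  rewrite ge0_ler_powR ?nnegrE ?subr_ge0 ?mprod_le ?exprn_ge0 ?(ltW c0) ?(ltW ts)//.
  exact: ltW.
Qed.

End CantorSet.

(** * The dimension of the intersection *)

Section Assembly.
Context {R : realType} {n q : nat}.
Local Notation V := 'rV[R]_n.
Context {A : 'M[bool]_q} {X : set V} {f : 'I_q -> V -> V} {ff : 'I_q -> 'I_q -> V -> V}.
Context (X_compact : compact X).
Context (f_conformal : forall i, conformal_contraction X (f i)).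
Context (ff_conformal : forall i j, occurs A i j -> conformal_contraction X (ff i j)).

Lemma compact_enorm_bounded : exists2 D : R, 0 < D &
  forall x y, X x -> X y -> enorm (x - y) <= D.
Proof.
have /compact_bounded[M [_ MP]] := X_compact.
pose M1 := Num.max M 0 + 1.
have M10 : 0 < M1 by rewrite ltr_wpDl// le_max lexx orbT.
have XM x : X x -> `|x| <= M1.
  by apply: MP; rewrite ltr_pwDr// le_max lexx.
exists (n.+1%:R * (M1 + M1)) => [|x y Xx Xy]; first by rewrite mulr_gt0// addr_gt0.
apply: le_trans (enorm_le_normr _) _; rewrite ler_wpM2l//.
by apply: le_trans (ler_normB _ _) _; rewrite lerD ?XM.
Qed.

(** The bounds for the single maps become uniform because the alphabet is finite. *)
Lemma conformal_system : exists c k D : R,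
  asymptotically_conformal X (edge A) ff c k D /\
  forall i x y, X x -> X y -> k * enorm (x - y) <= enorm (f i x - f i y).
Proof.
have [D D0 XD] := compact_enorm_bounded.
have [rc rc0 rcP] : exists2 r : R, 0 < r & forall ij t, ij \in enum {: 'I_q * 'I_q} ->
    0 < t <= r -> edge A ij.1 ij.2 -> forall x y, X x -> X y ->
    enorm (ff ij.1 ij.2 x - ff ij.1 ij.2 y) <= (1 - t) * enorm (x - y).
  apply: finite_uniform_radius => -[i j] _ /=.
  have [/asboolP ij|nij] := boolP (edge A i j); last by exists 1.
  have [_ [c c1 cP] _] := ff_conformal ij.
  exists (1 - c) => [|t /andP[t0 tc] _ x y Xx Xy]; first by rewrite subr_gt0.
  apply: le_trans (cP _ _ Xx Xy) _; rewrite ler_wpM2r ?enorm_ge0//; lra.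
have [r1 r10 r1P] : exists2 r : R, 0 < r & forall ij t, ij \in enum {: 'I_q * 'I_q} ->
    0 < t <= r -> edge A ij.1 ij.2 -> forall x y, X x -> X y ->
    t * enorm (x - y) <= enorm (ff ij.1 ij.2 x - ff ij.1 ij.2 y).
  apply: finite_uniform_radius => -[i j] _ /=.
  have [/asboolP ij|nij] := boolP (edge A i j); last by exists 1.
  have [_ _ conf] := ff_conformal ij.
  have [k k0 kP] := conformal_lower_lipschitz X_compact conf.
  exists k => // t /andP[t0 tk] _ x y Xx Xy.
  by apply: le_trans (kP _ _ Xx Xy); rewrite ler_wpM2r ?enorm_ge0.
have [r2 r20 r2P] : exists2 r : R, 0 < r & forall i t, i \in enum 'I_q ->
    0 < t <= r -> forall x y, X x -> X y ->
    t * enorm (x - y) <= enorm (f i x - f i y).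
  apply: finite_uniform_radius => i _.
  have [_ _ conf] := f_conformal i.
  have [k k0 kP] := conformal_lower_lipschitz X_compact conf.
  exists k => // t /andP[t0 tk] x y Xx Xy.
  by apply: le_trans (kP _ _ Xx Xy); rewrite ler_wpM2r ?enorm_ge0.
pose t := Num.min rc (2^-1); pose k := Num.min (Num.min r1 r2) 1.
have t0 : 0 < t by rewrite lt_min rc0/= invr_gt0 ltr0n.
have k0 : 0 < k by rewrite !lt_min r10 r20 ltr01.
exists (1 - t), k, D; split; last first.
  by move=> i; apply: r2P; rewrite ?mem_enum// k0 /k !ge_min lexx orbT.
split => //.
- have : t <= 2^-1 by rewrite ge_min lexx orbT.
  by move=> t1; apply/andP; split; lra.
- by rewrite k0 ge_min lexx orbT.
- move=> i j x /asboolP ij Xx; have [fX _ _] := ff_conformal ij.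
  by apply: fX; exists x.
- move=> i j x y ij; apply: (rcP (i, j)) => //; first by rewrite mem_enum.
  by rewrite t0 ge_min lexx.
- move=> i j x y ij; apply: (r1P (i, j)) => //; first by rewrite mem_enum.
  by rewrite k0 /k !ge_min lexx.
move=> d d0.
have [r r0 rP] : exists2 r : R, 0 < r & forall ij t, ij \in enum {: 'I_q * 'I_q} ->
    0 < t <= r -> edge A ij.1 ij.2 ->
    forall x y z u, X x -> X y -> X z -> X u ->
    enorm (y - x) < t -> enorm (z - x) < t -> enorm (u - x) < t ->
    enorm (ff ij.1 ij.2 x - ff ij.1 ij.2 y) * enorm (z - u) <=
      (1 + d) * enorm (ff ij.1 ij.2 z - ff ij.1 ij.2 u) * enorm (x - y).
  apply: finite_uniform_radius => -[i j] _ /=.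
  have [/asboolP ij|nij] := boolP (edge A i j); last by exists 1.
  have [_ _ conf] := ff_conformal ij.
  have [r r0 rP] := conformal_small_distortion X_compact conf d0.
  exists r => // b /andP[b0 br] _ x y z u Xx Xy Xz Xu yx zx ux.
  by apply: rP => //; exact: lt_le_trans br.
exists r => // i j x y z u ij; apply: (rP (i, j) r) => //; first by rewrite mem_enum.
by rewrite r0 lexx.
Qed.

End Assembly.

Theorem theorem2 (R : realType) (n q : nat) (A : 'M[bool]_q)
    (X : set 'rV[R]_n) (f : 'I_q -> 'rV[R]_n -> 'rV[R]_n)
    (ff : 'I_q -> 'I_q -> 'rV[R]_n -> 'rV[R]_n)
    (A_transitive : transitive_SFT A)
    (X_compact : compact X) (X_nonempty : X !=set0)
    (f_conformal : forall i, conformal_contraction X (f i))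
    (ff_conformal : forall i j, occurs A i j -> conformal_contraction X (ff i j))
    (X_regular : closure X° = X)
    (X_disjoint : disjoint_images A X f ff)
    (derivative_bounds : exists l1 l2 : R, [/\ 0 < l1, l1 < l2, l2 < 1,
       forall i, bounded_derivative X l1 l2 (f i) &
       forall i j, occurs A i j -> bounded_derivative X l1 l2 (ff i j)])
    (dimension_or_holder : (1 < n)%N \/
       (n = 1%N /\ exists alpha : R, [/\ 0 < alpha,
          forall i, holder_derivative X alpha (f i) &
          forall i j, occurs A i j -> holder_derivative X alpha (ff i j)]))
    (g : nat -> symbolic_space q -> R)
    (g_continuous : forall i, {within SFT A, continuous (g i)})
    (x : nat -> R) :
  hausdorff_dim (\bigcap_i [set y | limit_set A X f ff y /\
                              accumulation_set A X f ff (g i) y (x i)]) =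
  ereal_inf (range (fun i : nat =>
    hausdorff_dim [set y | limit_set A X f ff y /\
                     accumulation_set A X f ff (g i) y (x i)])).
Proof.
pose E i := [set y | limit_set A X f ff y /\ accumulation_set A X f ff (g i) y (x i)].
rewrite -/(\bigcap_i E i) -/(range (fun i => hausdorff_dim (E i))).
apply/eqP; rewrite eq_le; apply/andP; split.
  apply: le_ereal_inf_tmp => _ [i _ <-]; apply: le_hausdorff_dim => y Ey; exact: Ey.
have inf_le i : (ereal_inf (range (fun i => hausdorff_dim (E i))) <= hausdorff_dim (E i))%E.
  by apply: ereal_inf_lbound; exists i.
have [[s As]|noA] := pselect (exists s, SFT A s); last first.
  apply: le_trans (inf_le 0%N) _; apply: le_hausdorff_dim => y [[s As _] _].
  by case: noA; exists s.
have [c [k [D [S f_lower]]]] := conformal_system X_compact f_conformal ff_conformal.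
have f_contraction i y z : X y -> X z -> enorm (f i y - f i z) <= enorm (y - z).
  move=> Xy Xz; have [_ [b b1 bP] _] := f_conformal i.
  by apply: le_trans (bP _ _ Xy Xz) _; rewrite ler_piMl ?enorm_ge0// ltW.
apply: le_ereal_inf_tmp => _ [t [t0 tE] <-]; rewrite leNgt; apply/negP => tinf.
have [t1 tt1 t1inf] := lt_ereal_real tinf.
have [t2 t12 t2inf] := lt_ereal_real t1inf.
have oa : occurring A (s 0%N) by exists s.
apply: (cantor_subset X_compact X_nonempty S f_contraction f_lower A_transitive
  g_continuous (x0 := x) oa (le_lt_trans t0 tt1) t12).
  by move=> i; exact: lt_le_trans (inf_le i).
exact: (hausdorff_measure0_exponent t0 (ltW tt1)).
Qed.
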